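(* Let $\mathfrak{g}=\mathfrak{sl}_3(\mathbf{R})$ and let $\mathfrak{g}\to\mathrm{End}(W)$ be a faithful finite dimensional real representation such that there is a symmetric bilinear $\mathfrak{g}$-equivariant map $\wedge:W\times W\to W^*$ which does not vanish identically on any $2$-dimensional linear subspace of $W$. Then there exist integers $k\geq 0$ and $m\geq 0$ such that $W$ is isomorphic to $\mathrm{Sym}_2(E^* )\oplus E^k\oplus T^m$ or to its dual $\mathrm{Sym}_2(E)\oplus (E^* )^k\oplus T^m$.
   Context: $E=\mathbf{R}^3$ is the standard representation of $\mathfrak{sl}_3(\mathbf{R})$, $E^*$ its dual, $\mathrm{Sym}_2(E^* )$ the representation on quadratic forms on $E$, $T$ the trivial one-dimensional representation, and $V^k$ denotes the direct sum of $k$ copies of $V$. $W^*$ is the dual of $W$; equivariance of $\wedge$ means $X\cdot(a\wedge b)=(X\cdot a)\wedge b+a\wedge(X\cdot b)$. *)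

(* Defs.v *)
From HB Require Import structures.
From mathcomp Require Import all_boot all_order all_algebra.
Set Implicit Arguments. Unset Strict Implicit. Unset Printing Implicit Defensive.
Import GRing.Theory Num.Theory.
Local Open Scope ring_scope.

Section Defs.
Variable R : rcfType.

(* sl_3(R) = traceless 3x3 matrices; a representation of sl_3 on W = R^n is
   given by rho : 'M_3 -> 'M_n, used only on traceless matrices; rho X is the
   matrix (acting on column coordinates) of the endomorphism X of W. *)
Definition lie_rep n (rho : 'M[R]_3 -> 'M[R]_n) : Prop :=
  (forall (a : R) (X Y : 'M[R]_3), \tr X = 0 -> \tr Y = 0 ->
      rho (a *: X + Y) = a *: rho X + rho Y) /\
  (forall X Y : 'M[R]_3, \tr X = 0 -> \tr Y = 0 ->
      rho (X *m Y - Y *m X) = rho X *m rho Y - rho Y *m rho X).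

Definition faithful_rep n (rho : 'M[R]_3 -> 'M[R]_n) : Prop :=
  forall X : 'M[R]_3, \tr X = 0 -> rho X = 0 -> X = 0.

(* Vectors of W are row vectors w : 'rV_n; X . w := w *m (rho X)^T.
   Vectors of the dual of W are row vectors f : 'rV_n with pairing <f,w> = f *m w^T,
   so the dual action is X . f = - f *m rho X. *)
Definition act n (rho : 'M[R]_3 -> 'M[R]_n) (X : 'M[R]_3) (w : 'rV[R]_n) :
  'rV[R]_n := w *m (rho X)^T.
Definition dual_act n (rho : 'M[R]_3 -> 'M[R]_n) (X : 'M[R]_3) (f : 'rV[R]_n) :
  'rV[R]_n := - (f *m rho X).

Definition symmetric_bilinear n (wedge : 'rV[R]_n -> 'rV[R]_n -> 'rV[R]_n) :=
  (forall (a : R) u u' v, wedge (a *: u + u') v = a *: wedge u v + wedge u' v) /\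
  (forall (a : R) u v v', wedge u (a *: v + v') = a *: wedge u v + wedge u v') /\
  (forall u v, wedge u v = wedge v u).

Definition equivariant n (rho : 'M[R]_3 -> 'M[R]_n)
    (wedge : 'rV[R]_n -> 'rV[R]_n -> 'rV[R]_n) :=
  forall X : 'M[R]_3, \tr X = 0 -> forall a b : 'rV[R]_n,
    dual_act rho X (wedge a b) = wedge (act rho X a) b + wedge a (act rho X b).

Definition nonvanishing_on_planes n (wedge : 'rV[R]_n -> 'rV[R]_n -> 'rV[R]_n) :=
  forall U : 'M[R]_(2, n), \rank U = 2%N ->
    exists a b : 'rV[R]_n, [/\ (a <= U)%MS, (b <= U)%MS & wedge a b != 0].

Definition std_rep (X : 'M[R]_3) : 'M[R]_3 := X.
Definition triv_rep m (X : 'M[R]_3) : 'M[R]_m := 0.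
Definition stdk_rep k (X : 'M[R]_3) : 'M[R]_(3 * k) :=
  \matrix_(i, j) (if (i %/ 3 == j %/ 3)%N
                  then X (inord (i %% 3)) (inord (j %% 3)) else 0).
Definition dual_rep d (sigma : 'M[R]_3 -> 'M[R]_d) (X : 'M[R]_3) : 'M[R]_d :=
  - (sigma X)^T.
Definition sum_rep d1 d2 (s1 : 'M[R]_3 -> 'M[R]_d1) (s2 : 'M[R]_3 -> 'M[R]_d2)
  (X : 'M[R]_3) : 'M[R]_(d1 + d2) := block_mx (s1 X) 0 0 (s2 X).

(* Sym_2(E dual): quadratic forms q(v) = v^T S v on E, S symmetric, with action
   (X.q)(v) = -d/dt q(v + t X v), i.e. X.S = -(S X + X^T S).  Coordinates:
   the entries S_{p1 k, p2 k}, k < 6, with pairs (0,0),(1,1),(2,2),(0,1),(0,2),(1,2). *)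
Definition p1 (k : 'I_6) : 'I_3 := inord (nth 0%N [:: 0; 1; 2; 0; 0; 1]%N k).
Definition p2 (k : 'I_6) : 'I_3 := inord (nth 0%N [:: 0; 1; 2; 1; 2; 2]%N k).
Definition sym_idx (i j : 'I_3) : 'I_6 :=
  inord (if i == j then nat_of_ord i else (i + j + 2)%N).
Definition symmat (v : 'cV[R]_6) : 'M[R]_3 := \matrix_(i, j) v (sym_idx i j) 0.
Definition sym2dual_rep (X : 'M[R]_3) : 'M[R]_6 :=
  \matrix_(k, l)
    (- (symmat (delta_mx l 0) *m X + X^T *m symmat (delta_mx l 0))) (p1 k) (p2 k).

Definition model_rep k m : 'M[R]_3 -> 'M[R]_(6 + (3 * k + m)) :=
  sum_rep sym2dual_rep (sum_rep (stdk_rep k) (triv_rep m)).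

Definition iso_rep n d (rho : 'M[R]_3 -> 'M[R]_n) (sigma : 'M[R]_3 -> 'M[R]_d) :=
  exists P : 'M[R]_(d, n), [/\ row_free P, row_full P &
    forall X : 'M[R]_3, \tr X = 0 -> P *m rho X = sigma X *m P].

End Defs.

(* Main.v *)
Require Import Defs.
From HB Require Import structures.
From mathcomp Require Import all_boot all_order all_algebra.
From mathcomp Require Import zify ring lra.
Set Implicit Arguments. Unset Strict Implicit. Unset Printing Implicit Defensive.
Import Order.TTheory GRing.Theory Num.Theory.
Local Open Scope ring_scope.

(* Let h = E_ii - E_jj. By sl_2-theory h has integral eigenvalues on W. If M is the top
   eigenvalue of h and v a top eigenvector, sl_3-theory gives an eigenvector u for M - 1; the
   products of u and v lie in the eigenspaces of W dual for 2M, 2M - 1, 2M - 2, so nonvanishing on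
   the plane spanned by u and v forces M <= 2. Once |h| <= 2, h is diagonalizable by hand, so
   W is the sum of its weight spaces. The same trick with other planes shows that h has
   eigenvalue 2 with multiplicity one, that the eigenvector has weight 2 eps_i or -2 eps_j, and,
   in the second case, that the weights are among -2 eps_i, eps_i, 0. The first case reduces to
   the second by X |-> - X^T. The vectors of weight -2 eps_i then generate a copy of Sym_2(E dual),
   the vectors of weight eps_0 killed by E_12 and E_21 generate the copies of E, and the
   vectors of weight 0 are invariant (indices run from 0 to 2). *)

(** * Eigenvalues and sl_2-triples *)

(** The weights of W dual are the negatives of those of W, so the product of vectors of weights x
    and y vanishes as soon as -(x + y) is not a weight of W. Every exclusion of a weight comes from
    a plane on which all products vanish in this way. At the start the spectrum of h is not known to
    be symmetric, so its largest and least eigenvalues have to be bounded together. Complete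
    reducibility is never invoked: the bound |h| <= 2 makes short commutator computations
    sufficient. The eigenvalue 2 is simple because products of its eigenvectors would have
    eigenvalue 4. *)

Lemma eigenvalue_trmx (F : fieldType) n (A : 'M[F]_n) a :
  eigenvalue A^T a = eigenvalue A a.
Proof.
rewrite !eigenvalue_root_char; congr (root _ a).
rewrite /char_poly -[LHS]det_tr; congr (\det _).
by apply/matrixP => i j; rewrite !mxE eq_sym.
Qed.

Section SL2.
Variables (F : numFieldType) (n' : nat).
Local Notation n := n'.+1.
Variables (e f h : 'M[F]_n).
Hypotheses (he : h * e = e * h + 2 *: e) (hf : h * f = f * h - 2 *: f).
Hypothesis ef : e * f = f * e + h.

Lemma mul_h_exp_e k : h * e ^+ k = e ^+ k * h + (k.*2)%:R *: e ^+ k.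
Proof.
elim: k => [|k IHk]; first by rewrite expr0 mulr1 mul1r scale0r addr0.
rewrite exprS mulrA he mulrDl -mulrA IHk mulrDr !mulrA -exprS -scalerAl -exprS.
by rewrite -scalerAr -exprS -addrA -scalerDl -natrD addn2.
Qed.

(* The powers e^k are eigenvectors of ad h for pairwise distinct eigenvalues. *)
Lemma sl2_nilpotent : exists N, e ^+ N = 0.
Proof.
pose ad := lin_mx (mulmx h \- mulmxr h).
pose N := (n * n).+1.
have [[k ek0]|nz] : (exists k : 'I_N, e ^+ k = 0) \/ (forall k : 'I_N, e ^+ k != 0).
- case: (boolP [exists k : 'I_N, e ^+ k == 0]) => [/existsP[k /eqP]|]; first by left; exists k.
  by rewrite negb_exists => /forallP H; right.
- by exists k.
pose rs : seq F := [seq (k.*2)%:R | k <- iota 0 N].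
suff: (size rs < size (char_poly ad))%N by rewrite size_map size_iota size_char_poly ltnn.
apply: max_poly_roots.
- exact/monic_neq0/char_poly_monic.
- apply/allP => x /mapP[k]; rewrite mem_iota add0n => /andP[_ kN] {x}->.
  rewrite -eigenvalue_root_char; apply/eigenvalueP; exists (mxvec (e ^+ k)).
    rewrite mul_vec_lin /= -linearZ /=; congr mxvec.
    by rewrite -[h *m _]/(h * _) mul_h_exp_e addrC addKr.
  by rewrite mxvec_eq0 (nz (Ordinal kN)).
- rewrite map_inj_uniq ?iota_uniq // => i j /eqP; rewrite eqr_nat.
  by move/eqP/double_inj.
Qed.

Lemma exp_e_mul_f k :
  e ^+ k.+1 * f = f * e ^+ k.+1 + k.+1%:R *: (e ^+ k * (h + k%:R%:M)).
Proof.
elim: k => [|k IHk].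
  by rewrite !expr1 expr0 mul1r scale1r ef raddf0 addr0.
rewrite exprS -mulrA IHk mulrDr mulrA ef mulrDl mul_h_exp_e -mulrA -exprS.
rewrite -!addrA; congr (_ + _).
rewrite -[_%:R%:M]scalemx1 -[_.+1%:R%:M]scalemx1.
rewrite -scalerAr mulrA -exprS [in LHS]mulrDr [in RHS]mulrDr -!scalerAr !mulr1.
apply/matrixP => i j; move: (e ^+ k.+1 * h) (e ^+ k.+1) => A B.
rewrite !mxE -mul2n; ring.
Qed.

Definition prodh (s : seq int) : 'M[F]_n := \prod_(a <- s) (h - a%:~R%:M).

Lemma prodh_comm s A : h * A = A * h -> prodh s * A = A * prodh s.
Proof.
move=> hA; symmetry; apply: commr_prod => a _.
rewrite /GRing.comm mulrBr mulrBl hA; congr (_ - _).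
by rewrite -!mulmxE scalar_mxC.
Qed.

Lemma prodh_f s : prodh s * f = f * prodh [seq a + 2 | a <- s].
Proof.
elim: s => [|a s IHs]; first by rewrite /prodh !big_nil mul1r mulr1.
rewrite /prodh big_cons [in RHS]big_cons -/(prodh s) -/(prodh (map _ s)).
rewrite -mulrA IHs !mulrA; congr (_ * _).
rewrite mulrBl hf mulrBr -!mulmxE mul_scalar_mx mul_mx_scalar.
by rewrite rmorphD /= [_ + 2%:~R]addrC [in RHS]scalerDl opprD addrA.
Qed.

Lemma prodh_cat s t : prodh (s ++ t) = prodh s * prodh t.
Proof. by rewrite /prodh big_cat. Qed.

(* Jacobson: each commutator with f lowers the power of e at the cost of
   factors h - a with a integral. *)
Lemma sl2_annihilator : exists s : seq int, prodh s = 0.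
Proof.
have [N eN] := sl2_nilpotent.
suff H m s : e ^+ m * prodh s = 0 -> exists s' : seq int, prodh s' = 0.
  by apply: (H N [::]); rewrite eN mul0r.
elim: m s => [|m IHm] s E; first by exists s; rewrite -E mul1r.
pose s2 := [seq a + 2 | a <- s].
(* Multiply e^(m+1) [prodh s] = 0 on the right by f [prodh s]. Moving f to the left turns [prodh s]
   into [prodh s2], and the commutator of e^(m+1) with f contributes (m+1) e^m (h + m), which is the
   factor for the root -m. *)
apply: (IHm ((- m%:Z) :: s2 ++ s)).
have s2s : prodh s2 * prodh s = prodh s * prodh s2.
  by apply: prodh_comm; rewrite -prodh_comm.
have /eqP : m.+1%:R *: (e ^+ m * prodh ((- m%:Z) :: s2 ++ s)) = 0.
  have -> : prodh ((- m%:Z) :: s2 ++ s) = (h + m%:R%:M) * (prodh s2 * prodh s).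
    by rewrite -prodh_cat /prodh big_cons rmorphN raddfN opprK.
  have : e ^+ m.+1 * prodh s * (f * prodh s) = 0 by rewrite E mul0r.
  rewrite -!mulrA [_ * (f * _)]mulrA prodh_f -/s2 !mulrA exp_e_mul_f.
  rewrite !mulrDl -!mulrA s2s [e ^+ m.+1 * _]mulrA E mul0r mulr0 add0r.
  by rewrite -!scalerAl -!mulrA.
by rewrite scaler_eq0 pnatr_eq0 => /eqP.
Qed.

(** This gives integral eigenvalues without an algebraic closure: the minimal polynomial divides one
    that splits with integral roots. *)
Lemma mxminpoly_sl2 :
  exists s : seq int, mxminpoly h = \prod_(a <- s) ('X - a%:~R%:P).
Proof.
have [s hs] := sl2_annihilator.
have : mxminpoly h %| \prod_(a <- s) ('X - a%:~R%:P).
  apply: mxminpoly_min; rewrite rmorph_prod /= -[RHS]hs.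
  by apply: eq_bigr => a _; rewrite rmorphB /= horner_mx_X horner_mx_C.
case/dvdp_prod_XsubC => m; rewrite eqp_monic ?mxminpoly_monic ?monic_prod_XsubC //.
by move/eqP => E; exists (mask m s).
Qed.
End SL2.

Lemma not_uniq_perm (T : eqType) (s : seq T) :
  ~~ uniq s -> exists a t, perm_eq s [:: a, a & t].
Proof.
elim: s => //= x s IHs; case: (boolP (x \in s)) => [xs _|_ /= /IHs[a [t st]]].
  by exists x, (rem x s); rewrite perm_cons perm_to_rem.
exists a, (x :: t); rewrite -(perm_cons x) in st; apply: perm_trans st _.
by apply/permP => p /=; lia.
Qed.

(** If the minimal polynomial were r (X - a)^2, the rows of r(A) would be generalized eigenvectors
    of order two, hence eigenvectors, and r (X - a) would already kill A. *)
Lemma diagonalizable_semisimple (F : fieldType) n' (A : 'M[F]_n'.+1) (s : seq F) :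
    mxminpoly A = \prod_(a <- s) ('X - a%:P) ->
    (forall a (w : 'rV_n'.+1), a \in s ->
       (w *m A - a *: w) *m A = a *: (w *m A - a *: w) -> w *m A = a *: w) ->
  diagonalizable A.
Proof.
move=> pE ss; apply/diagonalizableP; exists s; last by rewrite pE.
apply/negPn/negP => /not_uniq_perm[a [t st]].
have as_ : a \in s by rewrite (perm_mem st) mem_head.
have hX : horner_mx A ('X - a%:P) = A - a%:M.
  by rewrite rmorphB /= horner_mx_X horner_mx_C.
pose r := \prod_(b <- t) ('X - b%:P).
have pE2 : mxminpoly A = r * ('X - a%:P) * ('X - a%:P).
  by rewrite pE (perm_big _ st) !big_cons /= -/r mulrA mulrC mulrA.
have : mxminpoly A %| r * ('X - a%:P).
  apply: mxminpoly_min; apply/row_matrixP => i; rewrite row0.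
  have := mx_root_minpoly A; rewrite pE2 !rmorphM /= hX => /(congr1 (row i)).
  rewrite row0 -!mulmxE !row_mul; move: (row i _) => w.
  by rewrite !mulmxBr !mul_mx_scalar => /eqP; rewrite subr_eq0 => /eqP/ss->;
     rewrite ?subrr.
have r0 : r * ('X - a%:P) != 0.
  by rewrite mulf_neq0 ?polyXsubC_eq0 // monic_neq0 ?monic_prod_XsubC.
move/(dvdp_leq r0); rewrite pE2 size_Mmonic ?monicXsubC //.
by rewrite size_XsubC addn2 /= ltnn.
Qed.

(** * The models Sym_2(E dual), E^k, T^m in coordinates *)

Lemma ord3P (i : 'I_3) : [\/ i = 0, i = 1 | i = 2].
Proof.
by case: i => [[|[|[|i]]] Hi] //; [apply: Or31|apply: Or32|apply: Or33]; apply: val_inj.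
Qed.

(* Here tt i j plays the role of the matrix unit E_ij: it acts on the squares sqv a and
   the symmetrized products sm a b as on Sym_2(E dual), on i |-> x i b as on the basis
   of E, and trivially on z. *)
Lemma sym_std_triv_indep (F : realFieldType) (V : lmodType F)
    (tt : 'I_3 -> 'I_3 -> V -> V) (sqv : 'I_3 -> V) (sm x : 'I_3 -> 'I_3 -> V) (z : V)
    (s0 s1 s2 s3 s4 s5 : F) :
    (forall i j u v, tt i j (u + v) = tt i j u + tt i j v) ->
    (forall i j a v, tt i j (a *: v) = a *: tt i j v) ->
    (forall i j a, i != j -> tt i j (sqv a) = - (a == i)%:R *: sm a j) ->
    (forall i j a b, i != j ->
       tt i j (sm a b) = - (a == i)%:R *: sm j b - (b == i)%:R *: sm a j) ->
    (forall a, sm a a = 2 *: sqv a) ->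
    (forall i j a b, i != j -> tt i j (x a b) = (j == a)%:R *: x i b) ->
    (forall i j, i != j -> tt i j z = 0) ->
    (forall a, sqv a != 0) ->
    s0 *: sqv 0 + s1 *: sqv 1 + s2 *: sqv 2 + s3 *: sm 0 1 + s4 *: sm 0 2 + s5 *: sm 1 2
     + (x 0 0 + x 1 1 + x 2 2) + z = 0 ->
  [/\ [/\ s0 = 0, s1 = 0 & s2 = 0], [/\ s3 = 0, s4 = 0 & s5 = 0] &
      [/\ x 0 1 = 0, x 0 2 = 0 & x 0 0 + x 1 1 + x 2 2 + z = 0]].
Proof.
move=> tD tZ tv ts sd tx tz v0 E.
have t0 i j : tt i j 0 = 0 by have := tZ i j 0 0; rewrite !scale0r.
(* The square of E_ij kills every [x a b], [z] and the mixed products, and sends [sqv i] to 2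
   [sqv j]; it isolates the coefficient of [sqv i]. *)
pose L i j u := tt i j (tt i j u).
have LD i j u v : L i j (u + v) = L i j u + L i j v by rewrite /L !tD.
have LZ i j a v : L i j (a *: v) = a *: L i j v by rewrite /L !tZ.
have Lv i j a : i != j -> L i j (sqv a) = (2 * (a == i)%:R) *: sqv j.
  move=> ij; have ji : (j == i) = false by rewrite eq_sym (negPf ij).
  rewrite /L (tv _ _ _ ij) tZ (ts _ _ _ _ ij) ji scale0r subr0 sd.
  by rewrite !scalerA; congr (_ *: _); case: (a == i) => /=; ring.
have Ls i j a b : i != j -> L i j (sm a b) = (4 * (a == i)%:R * (b == i)%:R) *: sqv j.
  move=> ij; have ji : (j == i) = false by rewrite eq_sym (negPf ij).
  rewrite /L (ts _ _ _ _ ij) -scaleNr tD !tZ !(ts _ _ _ _ ij) ji oppr0 !scale0r.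
  rewrite sub0r subr0 -scaleNr !sd !scalerA -scalerDl; congr (_ *: _); ring.
have Lx i j a b : i != j -> L i j (x a b) = 0.
  move=> ij; have ji : (j == i) = false by rewrite eq_sym (negPf ij).
  by rewrite /L (tx _ _ _ _ ij) tZ (tx _ _ _ _ ij) ji scale0r scaler0.
have LE i j : i != j ->
    (s0 * (2 * (0 == i)%:R) + s1 * (2 * (1 == i)%:R) + s2 * (2 * (2 == i)%:R)
    + s3 * (4 * (0 == i)%:R * (1 == i)%:R) + s4 * (4 * (0 == i)%:R * (2 == i)%:R)
    + s5 * (4 * (1 == i)%:R * (2 == i)%:R)) *: sqv j = 0.
  move=> ij; have := congr1 (L i j) E.
  rewrite [in RHS]/L !t0 => <-; rewrite !LD !LZ !(Lv _ _ _ ij) !(Ls _ _ _ _ ij) !(Lx _ _ _ _ ij).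
  by rewrite /L (tz _ _ ij) t0 !addr0 !scalerA -!scalerDl.
have vv a j : a *: sqv j = 0 -> a = 0.
  by move=> /eqP; rewrite scaler_eq0 (negPf (v0 j)) orbF => /eqP.
have e0 : s0 = 0 by have /vv := @LE 0 1 isT; rewrite /= => ?; lra.
have e1 : s1 = 0 by have /vv := @LE 1 0 isT; rewrite /= => ?; lra.
have e2 : s2 = 0 by have /vv := @LE 2 0 isT; rewrite /= => ?; lra.
rewrite e0 e1 e2 !scale0r !add0r in E; clear LE Lx Ls Lv LD LZ L.
(* Applying E_12 to this relation removes [x 0 1], and applying it once more leaves only a multiple
   of s3. *)
have E01 : - s3 *: sm 1 1 - s4 *: sm 1 2 + x 0 1 = 0.
  have := congr1 (tt 0 1) E; rewrite t0 => <-.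
  rewrite !(tD, tZ) !(@ts 0 1) // !(@tx 0 1) // (@tz 0 1) //=.
  by rewrite !(oppr0, scale0r, subr0, add0r, addr0, scale1r,
    scaleN1r, scaleNr, scalerN, scaler0).
have [e3 e4] : s3 = 0 /\ s4 = 0.
  have E12 : s3 *: sm 2 1 + s3 *: sm 1 2 + (2 * s4) *: sqv 2 = 0.
    have := congr1 (tt 1 2) E01; rewrite t0 => <-.
    rewrite -[- (s4 *: _)]scaleNr !(tD, tZ) !(@ts 1 2) // (@tx 1 2) //= sd.
    rewrite !(oppr0, scale0r, subr0, sub0r, addr0, scaleN1r, scale1r, scaleNr, scalerN, scalerA).
    by rewrite mul1r scalerBr scalerN opprD !opprK [s4 * 2]mulrC.
  have e3 : s3 = 0.
    have := congr1 (tt 1 2) E12; rewrite t0 !(tD, tZ) !(@ts 1 2) // (@tv 1 2) //= sd.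
    rewrite !(oppr0, scale0r, scaler0, subr0, sub0r, addr0, scale1r).
    rewrite scaleN1r !scalerN !scalerA -opprD -scalerDl => /eqP.
    by rewrite oppr_eq0 => /eqP/vv ?; lra.
  split=> //; move: E12; rewrite e3 !scale0r !add0r => /vv ?; lra.
have X1 : x 0 1 = 0 by move: E01; rewrite e3 e4 oppr0 !scale0r subr0 add0r.
rewrite e3 e4 !scale0r !add0r in E.
have X2 : x 0 2 = 0.
  have := congr1 (tt 0 2) E; rewrite t0 => <-.
  rewrite !(tD, tZ) !(@ts 0 2) // !(@tx 0 2) // (@tz 0 2) //=.
  by rewrite !(oppr0, scale0r, subr0, add0r, addr0, scale1r, scaler0).
(* E_12 maps [x 2 2] to [x 1 2], which would otherwise accompany the s5 term below. *)
have X12 : x 1 2 = 0.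
  have := congr1 (tt 1 0) X2; rewrite t0 (@tx 1 0) //= scale1r.
  by [].
have e5 : s5 = 0.
  have := congr1 (tt 1 2) E; rewrite t0 !(tD, tZ) !(@ts 1 2) // !(@tx 1 2) // (@tz 1 2) //= sd X12.
  rewrite !(oppr0, scale0r, subr0, sub0r, add0r, addr0, scale1r, scaler0).
  by rewrite -?scaleNr !scalerA => /vv ?; lra.
by split=> //; split=> //; rewrite e5 scale0r add0r in E.
Qed.

Section CopyIndex.
Variable k : nat.

Lemma copy_idx_subproof (a : 'I_k) (i : 'I_3) : (a * 3 + i < 3 * k)%N.
Proof. by have := ltn_ord a; have := ltn_ord i; lia. Qed.
(** Same layout as [stdk_rep]: the quotient by 3 is the copy of E, the remainder the basis
    vector. *)
Definition copy_idx (p : 'I_k * 'I_3) : 'I_(3 * k) := Ordinal (copy_idx_subproof p.1 p.2).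

Lemma copy_of_subproof (y : 'I_(3 * k)) : (y %/ 3 < k)%N.
Proof. by rewrite ltn_divLR //; have := ltn_ord y; lia. Qed.
Definition copy_of (y : 'I_(3 * k)) : 'I_k * 'I_3 :=
  (Ordinal (copy_of_subproof y), inord (y %% 3)).

Lemma copy_idx_div p : (copy_idx p %/ 3)%N = p.1.
Proof. by rewrite /= divnMDl // divn_small ?addn0. Qed.

Lemma copy_idx_mod p : inord (copy_idx p %% 3) = p.2 :> 'I_3.
Proof. by rewrite /= modnMDl modn_small // inord_val. Qed.

Lemma copy_idxK : cancel copy_idx copy_of.
Proof.
move=> p; rewrite /copy_of copy_idx_mod [p in RHS]surjective_pairing.
by congr (_, _); apply: val_inj; exact: copy_idx_div.
Qed.

Lemma copy_ofK : cancel copy_of copy_idx.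
Proof.
by move=> y; apply: val_inj; rewrite /= inordK ?ltn_pmod // -divn_eq.
Qed.

Lemma sum_copy (V : nmodType) (F : 'I_(3 * k) -> V) :
  \sum_y F y = \sum_a \sum_i F (copy_idx (a, i)).
Proof.
rewrite pair_big /= (reindex copy_idx) /=.
  by apply: eq_bigr => -[a i] _.
by apply: onW_bij; exists copy_of; [exact: copy_idxK | exact: copy_ofK].
Qed.
End CopyIndex.

Lemma big_ord3 (V : nmodType) (F : 'I_3 -> V) : \sum_i F i = F 0 + F 1 + F 2.
Proof.
rewrite !big_ord_recl big_ord0 addr0 addrA.
by congr (F _ + F _ + F _); apply: val_inj.
Qed.

Lemma big_ord6 (V : nmodType) (F : 'I_6 -> V) :
  \sum_i F i = F 0 + F 1 + F 2 + F 3 + F 4 + F 5.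
Proof.
rewrite !big_ord_recl big_ord0 addr0 !addrA.
by congr (F _ + F _ + F _ + F _ + F _ + F _); apply: val_inj.
Qed.

Lemma ord6P (i : 'I_6) : [\/ [\/ i = 0, i = 1 | i = 2] , i = 3 | i = 4 \/ i = 5].
Proof.
case: i => [[|[|[|[|[|[|i]]]]]] Hi] //.
- by apply/Or31/Or31/val_inj.
- by apply/Or31/Or32/val_inj.
- by apply/Or31/Or33/val_inj.
- by apply/Or32/val_inj.
- by apply/Or33; left; apply/val_inj.
- by apply/Or33; right; apply/val_inj.
Qed.

Lemma p12E : [/\ [/\ p1 0 = 0, p1 1 = 1 & p1 2 = 2], [/\ p1 3 = 0, p1 4 = 0 & p1 5 = 1],
  [/\ p2 0 = 0, p2 1 = 1 & p2 2 = 2] & [/\ p2 3 = 1, p2 4 = 2 & p2 5 = 2]].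
Proof. by split; split; apply: val_inj; rewrite /= inordK. Qed.

Lemma sym_idxK l : sym_idx (p1 l) (p2 l) = l.
Proof.
have [[a0 a1 a2] [a3 a4 a5] [b0 b1 b2] [b3 b4 b5]] := p12E.
by case: (ord6P l) => [[]||[]] ->; rewrite ?(a0, a1, a2, a3, a4, a5) ?(b0, b1, b2, b3, b4, b5);
  apply: val_inj; rewrite /= inordK.
Qed.

Lemma sym_idxC a b : sym_idx a b = sym_idx b a.
Proof.
have [->//|ab] := eqVneq a b.
by rewrite /sym_idx (negPf ab) eq_sym (negPf ab) [(b + a)%N]addnC.
Qed.

Section SymSum.
Variables (F : realFieldType) (V : lmodType F) (sm : 'I_3 -> 'I_3 -> V).

(** Passes from the derivation rule on symmetrized products to coefficient matrices, where the
    action takes the form used in [sym2dual_rep]. *)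
Lemma sym_action (D X : 'M[F]_3) :
  \sum_a \sum_b D a b *: (\sum_j (- X a j) *: sm j b + \sum_j (- X b j) *: sm a j) =
  \sum_a \sum_b (- (D *m X + X^T *m D)) a b *: sm a b.
Proof.
have E1 : \sum_a \sum_b D a b *: \sum_j (- X a j) *: sm j b =
    \sum_a \sum_b (- (X^T *m D) a b) *: sm a b.
  rewrite exchange_big /= [RHS]exchange_big; apply: eq_bigr => b _ /=.
  under eq_bigr => a _ do rewrite scaler_sumr.
  rewrite exchange_big; apply: eq_bigr => j _ /=.
  rewrite mxE -sumrN scaler_suml; apply: eq_bigr => a _.
  by rewrite mxE scalerA mulrN mulrC.
have E2 : \sum_a \sum_b D a b *: \sum_j (- X b j) *: sm a j =
    \sum_a \sum_b (- (D *m X) a b) *: sm a b.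
  apply: eq_bigr => a _ /=.
  under eq_bigr => b _ do rewrite scaler_sumr.
  rewrite exchange_big; apply: eq_bigr => j _ /=.
  rewrite mxE -sumrN scaler_suml; apply: eq_bigr => b _.
  by rewrite scalerA mulrN.
under eq_bigr => a _ do (under eq_bigr => b _ do rewrite scalerDr; rewrite big_split).
rewrite /= big_split /= E1 E2 -big_split; apply: eq_bigr => a _ /=.
rewrite -big_split; apply: eq_bigr => b _ /=.
by rewrite -scalerDl !mxE opprD addrC.
Qed.

(** The factor 1/2 arises because the double sum contains each mixed product twice and each diagonal
    product is twice a square. *)
Lemma sym_sum (sqv : 'I_3 -> V) (S : 'M[F]_3) :
    (forall a b, S a b = S b a) -> (forall a b, sm a b = sm b a) ->
    (forall a, sm a a = 2 *: sqv a) ->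
  \sum_l S (p1 l) (p2 l) *: (if p1 l == p2 l then sqv (p1 l) else sm (p1 l) (p2 l)) =
  2^-1 *: \sum_a \sum_b S a b *: sm a b.
Proof.
move=> SC sC sd; have [[a0 a1 a2] [a3 a4 a5] [b0 b1 b2] [b3 b4 b5]] := p12E.
rewrite big_ord6 !(a0, a1, a2, a3, a4, a5) !(b0, b1, b2, b3, b4, b5) /=.
rewrite !big_ord3 !sd (SC 1 0) (SC 2 0) (SC 2 1) (sC 1 0) (sC 2 0) (sC 2 1).
have A x (u : V) : 2^-1 *: (x *: (2 *: u)) = x *: u.
  by rewrite !scalerA; congr (_ *: _); field.
have B u : u = 2^-1 *: u + 2^-1 *: u :> V.
  by rewrite -scalerDl -[LHS]scale1r; congr (_ *: _); field.
rewrite !scalerDr !A.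
move: (S 0 1 *: _) (S 0 2 *: _) (S 1 2 *: _) (S 0 0 *: _) (S 1 1 *: _) (S 2 2 *: _).
move=> u v w p q r; rewrite [in LHS](B u) [in LHS](B v) [in LHS](B w).
by rewrite !addrA [RHS](ACl (1*5*9*2*4*3*7*6*8)).
Qed.

End SymSum.

(** * Weights of W *)

Section Rep.
Variables (R : rcfType) (n' : nat).
Local Notation n := n'.+1.
Variable rho : 'M[R]_3 -> 'M[R]_n.

Definition tr0 (X : 'M[R]_3) := X - (\tr X / 3%:R)%:M.

(* The extension of rho to gl_3 that kills the scalar matrices; it makes all the
   matrix units E_ij available without trace conditions. *)
Definition gl (X : 'M[R]_3) := rho (tr0 X).
(* M i j and T i j are the action of E_ij on W, which acts on row vectors from the
   right, and Hm i j, H i j are the action of E_ii - E_jj. *)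
Definition M (i j : 'I_3) := (gl (delta_mx i j))^T.
Definition Hm i j := M i i - M j j.

(* T and H are locked only to keep unification fast. *)
Fact T_key : unit. Proof. exact: tt. Qed.
Definition T i j (w : 'rV[R]_n) := locked_with T_key (w *m M i j).
Definition H i j (w : 'rV[R]_n) := locked_with T_key (w *m Hm i j).

Lemma TE i j w : T i j w = w *m M i j. Proof. exact: unlock. Qed.
Lemma HmE i j w : H i j w = w *m Hm i j. Proof. exact: unlock. Qed.
Lemma HE i j w : H i j w = T i i w - T j j w.
Proof. by rewrite HmE !TE mulmxBr. Qed.

Lemma TD i j v w : T i j (v + w) = T i j v + T i j w.
Proof. by rewrite !TE mulmxDl. Qed.
Lemma TN i j v : T i j (- v) = - T i j v.
Proof. by rewrite !TE mulNmx. Qed.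
Lemma TB i j v w : T i j (v - w) = T i j v - T i j w.
Proof. by rewrite TD TN. Qed.
Lemma TZ i j a v : T i j (a *: v) = a *: T i j v.
Proof. by rewrite !TE scalemxAl. Qed.
Lemma T0 i j : T i j 0 = 0.
Proof. by rewrite TE mul0mx. Qed.
Definition T_lin := (TD, TB, TN, TZ, T0).

Lemma HD i j v w : H i j (v + w) = H i j v + H i j w.
Proof. by rewrite !HmE mulmxDl. Qed.
Lemma HN i j v : H i j (- v) = - H i j v.
Proof. by rewrite !HmE mulNmx. Qed.
Lemma HB i j v w : H i j (v - w) = H i j v - H i j w.
Proof. by rewrite HD HN. Qed.
Lemma HZ i j a v : H i j (a *: v) = a *: H i j v.
Proof. by rewrite !HmE scalemxAl. Qed.
Lemma H0 i j : H i j 0 = 0.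
Proof. by rewrite HmE mul0mx. Qed.
Lemma Hm_anti i j : Hm j i = - Hm i j. Proof. by rewrite opprB. Qed.
Lemma H_anti i j w : H j i w = - H i j w.
Proof. by rewrite !HE opprB. Qed.
Lemma H_chain i j k w : H i k w = H i j w + H j k w.
Proof. by rewrite !HE addrA subrK. Qed.

Lemma tr_tr0 X : \tr (tr0 X) = 0.
Proof. by rewrite linearB /= mxtrace_scalar -[_ *+ 3]mulr_natr divfK ?subrr ?pnatr_eq0. Qed.

Lemma tr0_id X : \tr X = 0 -> tr0 X = X.
Proof. by rewrite /tr0 => ->; rewrite mul0r raddf0 subr0. Qed.

Hypothesis rhoL : lie_rep rho.

Lemma gl_is_linear : linear gl.
Proof.
move=> a X Y; rewrite /gl -(proj1 rhoL) ?tr_tr0 //; congr rho.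
apply/matrixP => i j; rewrite /tr0 linearP /= !mxE.
by case: (i == j); rewrite ?mulr1n ?mulr0n; ring.
Qed.
HB.instance Definition _ := GRing.isLinear.Build R _ _ _ gl gl_is_linear.

Lemma gl_id X : \tr X = 0 -> gl X = rho X.
Proof. by move=> /tr0_id X0; rewrite /gl X0. Qed.

Lemma gl_bracket X Y : gl (X *m Y - Y *m X) = gl X *m gl Y - gl Y *m gl X.
Proof.
rewrite gl_id; last by rewrite linearB /= mxtrace_mulC subrr.
rewrite /gl -(proj2 rhoL) ?tr_tr0 //; congr rho.
rewrite /tr0 !mulmxBr !mulmxBl !mul_scalar_mx !mul_mx_scalar !scale_scalar_mx.
apply/matrixP => i j; rewrite !mxE [_ / _ * _]mulrC; ring.
Qed.

Lemma M_comm i j k l :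
  M k l *m M i j = M i j *m M k l + (j == k)%:R *: M i l - (l == i)%:R *: M k j.
Proof.
rewrite /M -!trmx_mul.
have := gl_bracket (delta_mx i j) (delta_mx k l).
rewrite !mul_delta_mx_cond (linearB gl) !(linearMn gl) => E.
rewrite -[gl (delta_mx i j) *m _](subrK (gl (delta_mx k l) *m gl (delta_mx i j))).
by rewrite -E [LHS]linearD [X in X + _]linearB /= !(linearMn trmx) /= addrC !scaler_nat addrA.
Qed.

Lemma T_comm i j k l w : T i j (T k l w) =
  T k l (T i j w) + (j == k)%:R *: T i l w - (l == i)%:R *: T k j w.
Proof. by rewrite !TE -!mulmxA M_comm mulmxBr mulmxDr !scalemxAr. Qed.

(** The coefficient is the value of the root eps_k - eps_l at E_ii - E_jj. *)
Lemma H_T i j k l w : H i j (T k l w) = T k l (H i j w)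
  + ((i == k)%:R - (i == l)%:R - (j == k)%:R + (j == l)%:R) *: T k l w.
Proof.
rewrite !HE (T_comm i i) (T_comm j j) TB.
have E1 a : (a == k)%:R *: T a l w = (a == k)%:R *: T k l w.
  by case: eqP => [->|_]; rewrite ?scale0r.
have E2 a : (l == a)%:R *: T k a w = (a == l)%:R *: T k l w.
  by rewrite eq_sym; case: eqP => [->|_]; rewrite ?scale0r.
rewrite !E1 !E2; apply/matrixP => a b; rewrite !mxE; ring.
Qed.

Lemma H_T_eig i j k l w a : H i j w = a *: w -> H i j (T k l w) =
  (a + ((i == k)%:R - (i == l)%:R - (j == k)%:R + (j == l)%:R)) *: T k l w.
Proof. by move=> E; rewrite H_T E TZ scalerDl. Qed.

Lemma H_comm i j k l w : H i j (H k l w) = H k l (H i j w).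
Proof.
have E m : H i j (T m m w) = T m m (H i j w).
  rewrite H_T; set c := (X in _ + X *: _).
  by have -> : c = 0; [rewrite /c; ring | rewrite scale0r addr0].
by rewrite [H k l w]HE HB !E -HE.
Qed.

Lemma Hm_minpoly i j : i != j ->
  exists s : seq int, mxminpoly (Hm i j) = \prod_(a <- s) ('X - a%:~R%:P).
Proof.
move=> ij; have ji : (j == i) = false by rewrite eq_sym (negPf ij).
(* Matrices acting on row vectors from the right compose in reverse order, so E_ji takes the role of
   e. *)
apply: (@mxminpoly_sl2 _ _ (M j i) (M i j)); rewrite -!mulmxE.
- rewrite /Hm mulmxBl mulmxBr (M_comm j i i i) (M_comm j i j j) !eqxx ?ji ?(negPf ij).
  by rewrite /= !(scale0r, scale1r); apply/matrixP => a b; rewrite !mxE; ring.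
- rewrite /Hm mulmxBl mulmxBr (M_comm i j i i) (M_comm i j j j) !eqxx ?ji ?(negPf ij).
  by rewrite /= !(scale0r, scale1r); apply/matrixP => a b; rewrite !mxE; ring.
- by rewrite (M_comm i j j i) !eqxx !scale1r -addrA.
Qed.

Lemma H_eig_spec i j a w : w != 0 -> H i j w = a *: w -> eigenvalue (Hm i j) a.
Proof. by move=> w0; rewrite HmE => E; apply/eigenvalueP; exists w. Qed.

Lemma H_eig_eq0 i j a w : ~~ eigenvalue (Hm i j) a -> H i j w = a *: w -> w = 0.
Proof. by move=> na E; apply: contraNeq na => /H_eig_spec; apply. Qed.

Lemma H_geneig_eq0 i j a w : ~~ eigenvalue (Hm i j) a ->
  H i j (H i j w - a *: w) = a *: (H i j w - a *: w) -> w = 0.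
Proof.
move=> na /(H_eig_eq0 na)/eqP; rewrite subr_eq0 => /eqP.
exact: H_eig_eq0.
Qed.

Lemma eigenvalue_anti i j a : eigenvalue (Hm j i) (- a) = eigenvalue (Hm i j) a.
Proof.
apply/eigenvalueP/eigenvalueP => -[w E w0]; exists w => //.
  by move: E; rewrite Hm_anti mulmxN scaleNr => /oppr_inj.
by rewrite Hm_anti mulmxN scaleNr E.
Qed.

(** * The product, and the bound on the eigenvalues of E_ii - E_jj *)

Variable wedge : 'rV[R]_n -> 'rV[R]_n -> 'rV[R]_n.
Hypothesis wS : symmetric_bilinear wedge.
Hypothesis wE : equivariant rho wedge.
Hypothesis wP : nonvanishing_on_planes wedge.

Let wC u v : wedge u v = wedge v u.
Proof. by case: wS => _ [_]. Qed.
Let w0l v : wedge 0 v = 0.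
Proof.
by case: wS => L _; have := L (-1) 0 0 v; rewrite scaler0 addr0 scaleN1r addNr.
Qed.
Let wZl a u v : wedge (a *: u) v = a *: wedge u v.
Proof. by case: wS => L _; have := L a u 0 v; rewrite w0l !addr0. Qed.
Let wDl u u' v : wedge (u + u') v = wedge u v + wedge u' v.
Proof. by case: wS => L _; have := L 1 u u' v; rewrite !scale1r. Qed.
Let wZr a u v : wedge v (a *: u) = a *: wedge v u.
Proof. by rewrite !(wC v) wZl. Qed.
Let wDr u u' v : wedge v (u + u') = wedge v u + wedge v u'.
Proof. by rewrite !(wC v) wDl. Qed.
Let wBl u u' v : wedge (u - u') v = wedge u v - wedge u' v.
Proof. by rewrite -scaleN1r wDl wZl scaleN1r. Qed.
Let wBr u u' v : wedge v (u - u') = wedge v u - wedge v u'.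
Proof. by rewrite !(wC v) wBl. Qed.

Lemma T_wedge k l a b :
  - (wedge a b *m (M k l)^T) = wedge (T k l a) b + wedge a (T k l b).
Proof. by rewrite trmxK !TE; exact: (wE (tr_tr0 _)). Qed.

Lemma H_wedge i j a b :
  - (wedge a b *m (Hm i j)^T) = wedge (H i j a) b + wedge a (H i j b).
Proof.
by rewrite !HE wBl wBr addrACA -opprD -!T_wedge linearB /= mulmxBr opprB opprK addrC.
Qed.

(** By equivariance [wedge a b] would be an eigenvector of the transpose of [Hm i j] for -(x + y),
    and a matrix and its transpose have the same eigenvalues. *)
Lemma wedge_eig_eq0 i j x y a b :
  H i j a = x *: a -> H i j b = y *: b -> ~~ eigenvalue (Hm i j) (- (x + y)) ->
  wedge a b = 0.
Proof.
move=> Ea Eb; rewrite -eigenvalue_trmx; apply: contraNeq => nz.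
apply/eigenvalueP; exists (wedge a b) => //; apply: oppr_inj.
by rewrite H_wedge Ea Eb wZl wZr -scalerDl scaleNr opprK.
Qed.

(** The form in which nonvanishing on planes is used: if u and v span a plane, all its products are
    combinations of the three listed ones. *)
Lemma isotropic_colinear u v : v != 0 ->
  wedge v v = 0 -> wedge v u = 0 -> wedge u u = 0 -> exists c, u = c *: v.
Proof.
move=> v0 sqvec vu uu; have [/sub_rVP //|nuv] := boolP (u <= v)%MS.
have : \rank (col_mx u v) = 2%N.
  apply/eqP; rewrite eqn_leq rank_leq_row /= -addsmxE.
  apply: leq_trans (_ : (\rank v < \rank (u + v))%N); first by rewrite rank_rV v0.
  rewrite (ltn_leqif (mxrank_leqif_sup (addsmxSr u v))).
  by rewrite addsmx_sub submx_refl andbT.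
move/wP => [a [b []]].
have Eu x : (x <= col_mx u v)%MS -> exists p q, x = p *: u + q *: v.
  rewrite -addsmxE => /sub_addsmxP[[p q] /= ->].
  by exists (p 0 0), (q 0 0); rewrite [p]mx11_scalar [q]mx11_scalar !mul_scalar_mx !mxE.
case/Eu=> p [q ->]; case/Eu=> p' [q' ->] => /eqP[].
by rewrite !(wDl, wDr, wZl, wZr) sqvec vu uu (wC u v) vu !(scaler0, addr0).
Qed.

(* If v is a vector of top weight m for h = E_ii - E_jj, then E_jk v or E_ki v is a
   nonzero vector u of weight m - 1 (otherwise E_ji v = 0, hence h v = 0), and the plane
   spanned by u and v would be isotropic if 2m - 2 exceeded b. *)
Lemma top_bound i j k m b : i != j -> k != i -> k != j ->
  eigenvalue (Hm i j) m -> (forall a, eigenvalue (Hm i j) a -> - b <= a <= m) ->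
  m != 0 -> 2 * m - 2 <= b.
Proof.
move=> ij ki kj /eigenvalueP[v] + v0; rewrite -HmE => Ev bd m0; rewrite leNgt; apply/negP => lt.
have out a : a < - b \/ m < a -> ~~ eigenvalue (Hm i j) a.
  move=> oa; apply/negP => /bd; lra.
have [ik jk ji] : [/\ (i == k) = false, (j == k) = false & (j == i) = false].
  by rewrite !(eq_sym _ k) (eq_sym j) !(negPf ki, negPf kj, negPf ij).
have Eij : T i j v = 0.
  apply: (H_eig_eq0 (a := m + 2)); first by apply: out; right; lra.
  by rewrite (H_T_eig _ _ Ev) !eqxx (negPf ij) ji; congr (_ *: _); rewrite /=; ring.
have [u u0 Eu] : exists2 u, u != 0 & H i j u = (m - 1) *: u.
  have [u1|u1] := eqVneq (T j k v) 0; last first.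
    exists (T j k v) => //; rewrite (H_T_eig _ _ Ev) !eqxx (negPf ij) ik jk.
    by congr (_ *: _); rewrite /=; ring.
  have [u2|u2] := eqVneq (T k i v) 0; last first.
    exists (T k i v) => //; rewrite (H_T_eig _ _ Ev) !eqxx ji ik jk.
    by congr (_ *: _); rewrite /=; ring.
  have := T_comm j k k i v; rewrite u1 u2 !T0 eqxx (eq_sym i) ji scale1r scale0r.
  rewrite subr0 add0r => Eji.
  have := T_comm i j j i v; rewrite -Eji Eij !T0 !eqxx !scale1r add0r -HE.
  by rewrite Ev => /esym/eqP; rewrite scaler_eq0 (negPf m0) (negPf v0).
have [c uE] : exists c, u = c *: v.
  apply: isotropic_colinear => //.
  - by apply: (wedge_eig_eq0 Ev Ev); apply: out; left; lra.
  - by apply: (wedge_eig_eq0 Ev Eu); apply: out; left; lra.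
  - by apply: (wedge_eig_eq0 Eu Eu); apply: out; left; lra.
move: Eu; rewrite {1}uE HZ Ev scalerA mulrC -scalerA -uE.
move/eqP; rewrite -subr_eq0 -scalerBl opprB addrC subrK scale1r.
by rewrite (negPf u0).
Qed.

Lemma seq_max (s : seq R) x : x \in s -> exists2 m, m \in s & forall a, a \in s -> a <= m.
Proof.
elim: s x => // y s IHs x _; case: s IHs => [_|z s IHs].
  by exists y; rewrite ?mem_head // => a; rewrite inE => /eqP->.
have [m ms mm] := IHs z (mem_head _ _).
have [ym|my] := leP y m.
  exists m; first by rewrite inE ms orbT.
  by move=> a; rewrite inE => /predU1P[->|/mm].
exists y; first exact: mem_head.
move=> a; rewrite inE => /predU1P[-> //|/mm am]; exact: le_trans am (ltW my).
Qed.

Lemma third_index (i j : 'I_3) : i != j -> exists2 k, k != i & k != j.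
Proof.
by case: i j => [[|[|[|i]]] ?] [[|[|[|j]]] ?] //= _;
  [exists 2 | exists 1 | exists 2 | exists 0 | exists 1 | exists 0].
Qed.

Lemma spec_seq i j : i != j -> exists s : seq int,
  mxminpoly (Hm i j) = \prod_(a <- [seq z%:~R | z <- s]) ('X - a%:P) /\
  forall a, eigenvalue (Hm i j) a = (a \in [seq z%:~R | z <- s]).
Proof.
move=> /Hm_minpoly[s E]; exists s; rewrite big_map; split => // a.
by rewrite eigenvalue_root_min E -(big_map intr xpredT (fun a => 'X - a%:P)) root_prod_XsubC.
Qed.

(** Let m be the largest and -b the least eigenvalue. When they are nonzero, [top_bound] for (i, j)
    and for (j, i) gives 2m - 2 <= b and 2b - 2 <= m, and together these force m, b <= 2. *)
Lemma spec_bound i j a : i != j -> eigenvalue (Hm i j) a -> -2 <= a <= 2.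
Proof.
move=> ij; have [k ki kj] := third_index ij; have [s [_ sE]] := spec_seq ij.
rewrite sE => /[dup] /seq_max[m ms mm] as_.
set t := map _ s in sE ms mm as_.
have [b bs bm] : exists2 b, - b \in t & forall a, a \in t -> - b <= a.
  have [|b /mapP[c ct bE] bm] := @seq_max [seq - x | x <- t] (- a).
    exact: map_f.
  exists b; first by rewrite bE opprK.
  by move=> x xt; rewrite -lerN2 opprK; apply: bm; exact: map_f.
have H1 : m != 0 -> 2 * m - 2 <= b.
  apply: (@top_bound i j k) => //; first by rewrite sE.
  by move=> x; rewrite sE => xt; rewrite mm ?bm.
have H2 : b != 0 -> 2 * b - 2 <= m.
  apply: (@top_bound j i k) => //; first by rewrite eq_sym.
    by rewrite -eigenvalue_anti sE.
  move=> x; rewrite -eigenvalue_anti sE => xt.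
  by rewrite -lerN2 opprK mm //= -lerN2 bm.
have := mm _ as_; have := bm _ as_.
by have [m0|/H1 ?] := eqVneq m 0; have [b0|/H2 ?] := eqVneq b 0; lra.
Qed.

Lemma spec_int i j a : i != j -> eigenvalue (Hm i j) a ->
  exists2 z : int, a = z%:~R & -2 <= z <= 2.
Proof.
move=> ij ea; have := spec_bound ij ea; move: ea.
have [s [_ ->]] := spec_seq ij => /mapP[z _ ->] bd; exists z => //.
by rewrite -!(ler_int R) rmorphN.
Qed.

Lemma spec_out i j a : i != j -> a < -2 \/ 2 < a -> ~~ eigenvalue (Hm i j) a.
Proof. by move=> ij oa; apply/negP => /(spec_bound ij); lra. Qed.

(** * Diagonalizability of E_ii - E_jj and the weight decomposition *)

Lemma H_e i j w : i != j -> H i j (T i j w) = T i j (H i j w) + 2 *: T i j w.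
Proof.
move=> ij; rewrite H_T !eqxx (negPf ij) eq_sym (negPf ij).
by congr (_ + _ *: _); rewrite /=; ring.
Qed.

Lemma H_f i j w : i != j -> H i j (T j i w) = T j i (H i j w) - 2 *: T j i w.
Proof.
move=> ij; rewrite H_T !eqxx (negPf ij) eq_sym (negPf ij) -scaleNr.
by congr (_ + _ *: _); rewrite /=; ring.
Qed.

Lemma e_f i j w : i != j -> T i j (T j i w) = T j i (T i j w) + H i j w.
Proof. by move=> ij; rewrite T_comm !eqxx !scale1r HE addrA. Qed.

Lemma T_geneig i j k l w a c :
    (i == k)%:R - (i == l)%:R - (j == k)%:R + (j == l)%:R = c :> R ->
    H i j (H i j w - a *: w) = a *: (H i j w - a *: w) ->
  H i j (H i j (T k l w) - (a + c) *: T k l w) =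
    (a + c) *: (H i j (T k l w) - (a + c) *: T k l w).
Proof.
move=> cE E.
have -> : H i j (T k l w) - (a + c) *: T k l w = T k l (H i j w - a *: w).
  by rewrite H_T cE TB TZ; apply/rowP => x; rewrite !mxE; ring.
by rewrite (H_T_eig _ _ E) cE.
Qed.

Lemma e_geneig i j w a : i != j ->
    H i j (H i j w - a *: w) = a *: (H i j w - a *: w) ->
  H i j (H i j (T i j w) - (a + 2) *: T i j w) =
    (a + 2) *: (H i j (T i j w) - (a + 2) *: T i j w).
Proof.
move=> ij; apply: T_geneig.
by rewrite !eqxx (negPf ij) eq_sym (negPf ij) /=; ring.
Qed.

Lemma f_geneig i j w a : i != j ->
    H i j (H i j w - a *: w) = a *: (H i j w - a *: w) ->
  H i j (H i j (T j i w) - (a - 2) *: T j i w) =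
    (a - 2) *: (H i j (T j i w) - (a - 2) *: T j i w).
Proof.
move=> ij; apply: T_geneig.
by rewrite !eqxx (negPf ij) eq_sym (negPf ij) /=; ring.
Qed.

Lemma geneig_out i j w a : i != j -> a < -2 \/ 2 < a ->
  H i j (H i j w - a *: w) = a *: (H i j w - a *: w) -> w = 0.
Proof. by move=> ij oa; apply: H_geneig_eq0; exact: spec_out. Qed.

(** With u = (h - 1) w, the bound on eigenvalues gives e w = 0 and f^2 w = 0. Expanding e f^2 w = 0
    yields 2 f u = 0; so e and f kill u, hence so does h, which acts on u by 1. *)
Lemma semisimple_1 i j w : i != j ->
  H i j (H i j w - 1 *: w) = 1 *: (H i j w - 1 *: w) -> H i j w = 1 *: w.
Proof.
move=> ij E.
have ew : T i j w = 0 by apply: (geneig_out ij _ (e_geneig ij E)); right; lra.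
have ffw : T j i (T j i w) = 0.
  by apply: (geneig_out ij _ (f_geneig ij (f_geneig ij E))); left; lra.
have Ee := e_f (T j i w) ij.
rewrite ffw T0 (e_f w ij) ew T0 add0r H_f // in Ee.
set u := H i j w - 1 *: w in E.
have fu : T j i u = 0.
  have /eqP : 2 *: T j i u = 0.
    by rewrite [RHS]Ee /u TB TZ; apply/rowP => x; rewrite !mxE; ring.
  by rewrite scaler_eq0 pnatr_eq0 => /eqP.
have eu : T i j u = 0.
  rewrite /u TB TZ -[T i j (H i j w)](addrK (2 *: T i j w)) -H_e //.
  by rewrite ew H0 !scaler0 !subr0.
have := e_f u ij; rewrite fu eu !T0 add0r E => /esym/eqP.
by rewrite scale1r subr_eq0 => /eqP.
Qed.

(** Here u = (h - 2) w and only f^3 w = 0 is available: e f^3 w = 0 yields 3 f^2 u = 0, then e f^2 u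
    = 0 yields 2 f u = 0, and again h u = 0. *)
Lemma semisimple_2 i j w : i != j ->
  H i j (H i j w - 2 *: w) = 2 *: (H i j w - 2 *: w) -> H i j w = 2 *: w.
Proof.
move=> ij E.
have ew : T i j w = 0 by apply: (geneig_out ij _ (e_geneig ij E)); right; lra.
have fffw : T j i (T j i (T j i w)) = 0.
  by apply: (geneig_out ij _ (f_geneig ij (f_geneig ij (f_geneig ij E)))); left; lra.
set u := H i j w - 2 *: w in E.
have eu : T i j u = 0.
  rewrite /u TB TZ -[T i j (H i j w)](addrK (2 *: T i j w)) -H_e //.
  by rewrite ew H0 !scaler0 !subr0.
have ffu : T j i (T j i u) = 0.
  have /eqP : 3 *: T j i (T j i u) = 0.
    have := e_f (T j i (T j i w)) ij.
    rewrite fffw T0 (e_f (T j i w) ij) (e_f w ij) ew T0 add0r !H_f // /u !T_lin.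
    by move=> ->; apply/rowP => x; rewrite !mxE; ring.
  by rewrite scaler_eq0 pnatr_eq0 => /eqP.
have fu : T j i u = 0.
  have /eqP : 2 *: T j i u = 0.
    have := e_f (T j i u) ij.
    rewrite ffu T0 (e_f u ij) eu T0 add0r !H_f // E !T_lin.
    by move=> ->; apply/rowP => x; rewrite !mxE; ring.
  by rewrite scaler_eq0 pnatr_eq0 => /eqP.
have := e_f u ij; rewrite fu eu !T0 add0r E => /esym/eqP.
by rewrite scaler_eq0 pnatr_eq0 subr_eq0 => /eqP.
Qed.

(* With h^2 w = 0, the vector z = e f w / 2 satisfies e z = e w and f z = f w,
   so w - z is invariant, while h z = 0. *)
Lemma semisimple_0 i j w : i != j ->
  H i j (H i j w - 0 *: w) = 0 *: (H i j w - 0 *: w) -> H i j w = 0 *: w.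
Proof.
move=> ij E; have ji : j != i by rewrite eq_sym.
have eew : T i j (T i j w) = 0.
  by apply: (geneig_out ij _ (e_geneig ij (e_geneig ij E))); right; lra.
have ffw : T j i (T j i w) = 0.
  by apply: (geneig_out ij _ (f_geneig ij (f_geneig ij E))); left; lra.
have Ef : H i j (T j i w) = - 2 *: T j i w.
  apply: oppr_inj; rewrite -H_anti scaleNr opprK; apply: semisimple_2 => //.
  have := f_geneig ij E; rewrite add0r => E'.
  rewrite (H_anti i j) (H_anti i j (T j i w)).
  have -> : - H i j (T j i w) - 2 *: T j i w = - (H i j (T j i w) - - 2 *: T j i w).
    by rewrite opprB scaleNr addrC.
  by rewrite HN E' opprK -scaleNr scalerN -scaleNr opprK.
have Ee : H i j (T i j w) = 2 *: T i j w.
  by apply: semisimple_2 => //; have := e_geneig ij E; rewrite add0r.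
set z := 2^-1 *: T i j (T j i w).
have ez : T i j z = T i j w.
  have eH : T i j (H i j w) = 0.
    by apply: (addIr (2 *: T i j w)); rewrite -H_e // Ee add0r.
  rewrite /z TZ (e_f w ij) TD eH addr0.
  by rewrite (e_f (T i j w) ij) eew T0 add0r Ee scalerA mulVf ?scale1r ?pnatr_eq0.
have fz : T j i z = T j i w.
  rewrite /z TZ (e_f (T j i w) ji) ffw T0 add0r H_anti Ef scaleNr opprK.
  by rewrite scalerA mulVf ?scale1r ?pnatr_eq0.
have Hz : H i j z = 0.
  by rewrite /z HZ H_e // Ef TZ scaleNr addNr scaler0.
have := e_f (w - z) ij; rewrite !TB ez fz !subrr add0r HB Hz subr0 scale0r.
by move=> <-.
Qed.

Lemma Hm_diagonalizable i j : i != j -> diagonalizable (Hm i j).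
Proof.
move=> ij; have ji : j != i by rewrite eq_sym.
have [s [pE sE]] := spec_seq ij.
apply: diagonalizable_semisimple pE _ => a w; rewrite -sE -!HmE.
move=> /(spec_int ij)[z -> /andP[z1 z2]].
(* Exchanging i and j reduces negative eigenvalues to positive ones. *)
have neg (c : R) : (forall v, H j i (H j i v - c *: v) = c *: (H j i v - c *: v) ->
     H j i v = c *: v) ->
   H i j (H i j w - - c *: w) = - c *: (H i j w - - c *: w) -> H i j w = - c *: w.
  move=> S E; apply: oppr_inj; rewrite -H_anti scaleNr opprK; apply: S.
  have -> : H j i w - c *: w = - (H i j w - - c *: w).
    by rewrite H_anti opprB scaleNr addrC.
  by rewrite HN (H_anti i j) E opprK scalerN -scaleNr.
have : z \in [:: -2; -1; 0; 1; 2] by rewrite !inE; lia.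
rewrite !inE => /or4P[/eqP->|/eqP->|/eqP->|/orP[/eqP->|/eqP->]].
- by apply: neg => v; exact: semisimple_2.
- by apply: neg => v; exact: semisimple_1.
- exact: semisimple_0.
- exact: semisimple_1.
- exact: semisimple_2.
Qed.

(* w has weight sum_i c_i eps_i; c only matters up to adding a constant. *)
Definition wt (c : 'I_3 -> int) w := forall i j, H i j w = (c i - c j)%:~R *: w.

Lemma H_ii i w : H i i w = 0. Proof. by rewrite HE subrr. Qed.

Lemma wt_ext c c' w : (forall i j, c i - c j = c' i - c' j) -> wt c w -> wt c' w.
Proof. by move=> E wc i j; rewrite wc E. Qed.

Lemma wtD c u v : wt c u -> wt c v -> wt c (u + v).
Proof. by move=> cu cv i j; rewrite HD cu cv scalerDr. Qed.

Lemma wtZ c a v : wt c v -> wt c (a *: v).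
Proof. by move=> cv i j; rewrite HZ cv !scalerA mulrC. Qed.

Lemma wtN c v : wt c v -> wt c (- v).
Proof. by move=> cv; rewrite -scaleN1r; exact: wtZ. Qed.

Lemma wtB c u v : wt c u -> wt c v -> wt c (u - v).
Proof. by move=> cu cv; apply: wtD => //; exact: wtN. Qed.

Lemma wt_of_H a b w : H 0 1 w = a%:~R *: w -> H 1 2 w = b%:~R *: w ->
  wt (fun i => nth 0 [:: a + b; b; 0] i) w.
Proof.
move=> Ea Eb.
have Ec : H 0 2 w = (a + b)%:~R *: w by rewrite (H_chain 0 1 2) Ea Eb -scalerDl intrD.
by move=> i j; case: (ord3P i) => ->; case: (ord3P j) => ->;
  rewrite /= ?H_ii ?(H_anti 0 1) ?(H_anti 1 2) ?(H_anti 0 2) ?Ea ?Eb ?Ec ?subrr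
    ?scale0r // -?scaleNr; congr (_ *: _); rewrite -?rmorphN /=; congr (_%:~R); ring.
Qed.

Lemma wtT c k l w : wt c w -> wt (fun i => c i + (i == k)%:Z - (i == l)%:Z) (T k l w).
Proof.
move=> wc i j; rewrite (H_T_eig _ _ (wc i j)); congr (_ *: _).
rewrite !(rmorphB, rmorphD) /=; ring.
Qed.

Lemma wt_out i j c w : wt c w -> i != j -> 2 < c i - c j -> w = 0.
Proof.
move=> wc ij lt; apply: H_eig_eq0 (wc i j); apply: spec_out => //; right.
by rewrite -[2]/(2%:~R) ltr_int.
Qed.

Lemma wt_bound i j c w : wt c w -> w != 0 -> i != j -> c i - c j <= 2.
Proof. by move=> wc w0 ij; rewrite leNgt; apply: contraNN w0 => /(wt_out wc ij)->. Qed.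

(** [Hm 0 1] and [Hm 1 2] commute and are diagonalizable; the rows of a matrix that diagonalizes
    both are weight vectors and form a basis. *)
Lemma wt_span m (A : 'M[R]_(m, n)) :
  (forall c w, wt c w -> w != 0 -> (w <= A)%MS) -> row_full A.
Proof.
move=> cA.
have [|P Pu] := (codiagonalizableP [:: Hm 0 1; Hm 1 2]).1.
  split=> [A1 A2|A1]; rewrite !inE.
    have HH : Hm 0 1 *m Hm 1 2 = Hm 1 2 *m Hm 0 1.
      apply/row_matrixP => i.
      by rewrite !row_mul -[LHS]HmE -[RHS]HmE rowE [in RHS]rowE -!HmE H_comm.
    by move=> /orP[]/eqP-> /orP[]/eqP->; [exact: erefl | exact: HH | exact: esym HH | exact: erefl].
  by move=> /orP[]/eqP->; exact: Hm_diagonalizable.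
case/andP=> d1 /andP[d2 _].
have [D1 /(simmxP Pu) E1] := diagonalizable_forPex d1.
have [D2 /(simmxP Pu) E2] := diagonalizable_forPex d2.
rewrite -sub1mx -(mulVmx Pu); apply: mulmx_sub; apply/row_subP => i.
have nz : row i P != 0.
  apply/eqP => r0; have : row i P *m invmx P = 0 by rewrite r0 mul0mx.
  rewrite -row_mul mulmxV // => /rowP/(_ i)/eqP.
  by rewrite !mxE eqxx oner_eq0.
have F1 : H 0 1 (row i P) = D1 0 i *: row i P.
  by rewrite HmE -row_mul E1; apply/rowP => x; rewrite mul_diag_mx !mxE.
have F2 : H 1 2 (row i P) = D2 0 i *: row i P.
  by rewrite HmE -row_mul E2; apply/rowP => x; rewrite mul_diag_mx !mxE.
have [//|a aE _] := spec_int _ (H_eig_spec nz F1).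
have [//|b bE _] := spec_int _ (H_eig_spec nz F2).
rewrite aE in F1; rewrite bE in F2.
exact: cA (wt_of_H F1 F2) nz.
Qed.

(** All products of u and v would need the eigenvalue -4 on W. *)
Lemma H_2_line i j u v : i != j -> v != 0 -> H i j v = 2 *: v -> H i j u = 2 *: u ->
  exists c, u = c *: v.
Proof.
move=> ij v0 Ev Eu; have out : ~~ eigenvalue (Hm i j) (- (2 + 2)).
  by apply: spec_out => //; left; lra.
by apply: isotropic_colinear => //;
  [exact: (wedge_eig_eq0 Ev Ev out) | exact: (wedge_eig_eq0 Ev Eu out)
  | exact: (wedge_eig_eq0 Eu Eu out)].
Qed.

(** As -4 is no eigenvalue, f v = 0 and so f e v = 2 v. If e e v = 0, then e f e v = 0 because h e v
    = 0; thus e v = 0, and finally h v = 0. *)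
Lemma ee_inj i j v : i != j -> H i j v = - 2 *: v -> T i j (T i j v) = 0 -> v = 0.
Proof.
move=> ij Ev ee.
have fv : T j i v = 0.
  apply: (@H_eig_eq0 i j (- 4)); first by apply: spec_out => //; left; lra.
  by rewrite H_f // Ev TZ -scalerBl; congr (_ *: _); ring.
have Ee : H i j (T i j v) = 0 by rewrite H_e // Ev TZ -scalerDl addNr scale0r.
have e0 : T i j v = 0.
  have := e_f (T i j v) ij; rewrite ee T0 add0r Ee.
  have /eqP := e_f v ij; rewrite fv T0 Ev eq_sym scaleNr subr_eq0 => /eqP->.
  by rewrite TZ => /eqP; rewrite scaler_eq0 pnatr_eq0 => /eqP.
have := e_f v ij; rewrite fv e0 !T0 add0r Ev => /esym/eqP.
by rewrite scaler_eq0 oppr_eq0 pnatr_eq0 => /eqP.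
Qed.

Lemma eig_N2 i j : i != j -> eigenvalue (Hm i j) (- 2) -> eigenvalue (Hm i j) 2.
Proof.
move=> ij /eigenvalueP[v]; rewrite -HmE => Ev v0.
apply: (@H_eig_spec _ _ _ (T i j (T i j v))).
  by apply: contraNneq v0 => /(ee_inj ij Ev)->.
rewrite H_e // H_e // Ev !T_lin; apply/rowP => x; rewrite !mxE; ring.
Qed.

(* If 2 and -2 are not weights, a vector w of weight 1 and f w span an isotropic plane. *)
Lemma no_weight_1 i j : i != j -> ~~ eigenvalue (Hm i j) 2 -> ~~ eigenvalue (Hm i j) 1.
Proof.
move=> ij n2; have nN2 := contraNN (eig_N2 ij) n2.
apply/negP => /eigenvalueP[w]; rewrite -HmE => Ew w0.
have ew : T i j w = 0.
  apply: (@H_eig_eq0 i j 3); first by apply: spec_out => //; right; lra.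
  by rewrite H_e // Ew TZ -scalerDl; congr (_ *: _); ring.
have Eu : H i j (T j i w) = -1 *: T j i w.
  by rewrite H_f // Ew TZ -scalerBl; congr (_ *: _); ring.
have efw : T i j (T j i w) = w by rewrite e_f // ew T0 add0r Ew scale1r.
have ww : wedge w w = 0 by apply: (wedge_eig_eq0 Ew Ew).
have uu : wedge (T j i w) (T j i w) = 0.
  by apply: (wedge_eig_eq0 Eu Eu); rewrite -opprD opprK.
have wu : wedge w (T j i w) = 0.
  have /eqP := T_wedge i j (T j i w) (T j i w).
  rewrite uu mul0mx oppr0 efw [wedge _ w]wC -mulr2n -scaler_nat eq_sym.
  by rewrite scaler_eq0 pnatr_eq0 => /eqP.
have [c uE] := isotropic_colinear w0 ww wu uu.
have : 2 *: T j i w = 0.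
  have := Eu; rewrite {1}uE HZ Ew scale1r -uE => /eqP.
  by rewrite -subr_eq0 -{1}[T j i w]scale1r -scalerBl opprK => /eqP.
move=> /eqP; rewrite scaler_eq0 pnatr_eq0 => /eqP u0.
by move: w0; rewrite -efw u0 T0 eqxx.
Qed.

(** * Existence of the weight 2 eps_0 or -2 eps_2 *)

Hypothesis rhoF : faithful_rep rho.

Lemma tr_delta m (i : 'I_m) : \tr (delta_mx i i : 'M[R]_m) = 1.
Proof.
rewrite /mxtrace (bigD1 i) //= mxE eqxx big1 ?addr0 // => k /negPf ki.
by rewrite mxE ki.
Qed.

Lemma Hm_neq0 i j : i != j -> Hm i j != 0.
Proof.
move=> ij; apply/eqP => /eqP; rewrite subr_eq0 => /eqP /trmx_inj E.
have t0 : \tr (delta_mx i i - delta_mx j j : 'M[R]_3) = 0.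
  by rewrite raddfB /= !tr_delta subrr.
have g0 : gl (delta_mx i i - delta_mx j j) = 0 
  by rewrite (linearB gl) -[RHS](subrr (gl (delta_mx j j))); congr (_ - _); exact: E.
rewrite gl_id // in g0; have /matrixP/(_ i i) := rhoF t0 g0.
by rewrite !mxE !eqxx (negPf ij) /= subr0 => /eqP; rewrite oner_eq0.
Qed.

(** Without the eigenvalue 2, none of -2, 1, -1 occurs either, and the diagonalizable [Hm i j] would
    be zero, against faithfulness. *)
Lemma exists_weight_2 i j : i != j -> eigenvalue (Hm i j) 2.
Proof.
move=> ij; apply: contraT => n2; have ji : j != i by rewrite eq_sym.
have nN2 := contraNN (eig_N2 ij) n2.
have n1 := no_weight_1 ij n2.
have nN1 : ~~ eigenvalue (Hm i j) (- 1).
  rewrite (eigenvalue_anti j i 1); apply: (no_weight_1 ji).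
  rewrite -(eigenvalue_anti j i 2); exact: nN2.
have [P Pu /diagonalizable_forPex[D /(simmxP Pu) E]] := Hm_diagonalizable ij.
case/eqP: (Hm_neq0 ij); rewrite -[Hm i j]mul1mx -(mulVmx Pu) -mulmxA E.
suff -> : diag_mx D *m P = 0 by rewrite mulmx0.
apply/row_matrixP => k; rewrite row0.
have rk : row k P *m Hm i j = D 0 k *: row k P.
  by rewrite -row_mul E; apply/rowP => x; rewrite mul_diag_mx !mxE.
have -> : row k (diag_mx D *m P) = D 0 k *: row k P.
  by apply/rowP => x; rewrite mul_diag_mx !mxE.
have [->|nz] := eqVneq (row k P) 0; first by rewrite scaler0.
rewrite -HmE in rk; have := H_eig_spec nz rk.
move=> /[dup] /(spec_int ij)[z -> /andP[z1 z2]].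
have : z \in [:: -2; -1; 0; 1; 2] by rewrite !inE; lia.
by rewrite !inE => /or4P[/eqP->|/eqP->|/eqP->|/orP[/eqP->|/eqP->]];
  rewrite ?(negPf n2, negPf nN2, negPf n1, negPf nN1) // scale0r.
Qed.

(** Such a v has the weight eps_i - eps_j of the adjoint representation. E_jk v and E_ki v have
    eigenvalue 2 for E_ii - E_kk and E_kk - E_jj respectively, so their squares vanish; paired with
    v they would span isotropic planes, hence both are zero. Then E_ji v = 0, and E_ij v = 0 by the
    bound, so h v = 0. *)
Lemma no_root_weight i j k v : i != j -> k != i -> k != j ->
  H i j v = 2 *: v -> H i k v = 1 *: v -> v = 0.
Proof.
move=> ij ki kj Ev Eik; apply/eqP/negPn/negP => v0.
have [ik jk ji] : [/\ (i == k) = false, (j == k) = false & (j == i) = false].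
  by rewrite !(eq_sym _ k) (eq_sym j) !(negPf ki, negPf kj, negPf ij).
have Ekj : H k j v = 1 *: v.
  have -> : 1 *: v = 2 *: v - 1 *: v by rewrite -scalerBl; congr (_ *: _); ring.
  by rewrite -Ev -Eik (H_chain i k j) addrC addKr.
have out c : 2 < c -> ~~ eigenvalue (Hm i j) (- c).
  by move=> c2; apply: spec_out => //; left; lra.
have col u : H i j u = 1 *: u -> wedge u u = 0 -> u = 0.
  move=> Eu uu.
  have [||//|c uE] := @isotropic_colinear u v v0.
  - by apply: (wedge_eig_eq0 Ev Ev); apply: out; lra.
  - by apply: (wedge_eig_eq0 Ev Eu); apply: out; lra.
  have := Eu; rewrite {1}uE HZ Ev scalerA mulrC -scalerA -uE => /eqP.
  rewrite -subr_eq0 -scalerBl scaler_eq0 => /orP[|/eqP //].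
  by rewrite (_ : _ - _ = 1) ?oner_eq0 //; ring.
have u1 : T j k v = 0.
  apply: col => //.
    by rewrite (H_T_eig _ _ Ev) !eqxx ?ik ?jk ?ji ?(negPf ij); congr (_ *: _); rewrite /=; ring.
  apply: (@wedge_eig_eq0 i k 2 2); try
    by rewrite (H_T_eig _ _ Eik) !eqxx ?ik ?jk ?ji ?(negPf ij) ?(negPf ki) ?(negPf kj);
       congr (_ *: _); rewrite /=; ring.
  by apply: spec_out; [rewrite eq_sym | left; lra].
have u2 : T k i v = 0.
  apply: col => //.
    by rewrite (H_T_eig _ _ Ev) !eqxx ?ik ?jk ?ji ?(negPf ij); congr (_ *: _); rewrite /=; ring.
  apply: (@wedge_eig_eq0 k j 2 2); try
    by rewrite (H_T_eig _ _ Ekj) !eqxx ?ik ?jk ?ji ?(negPf ij) ?(negPf ki) ?(negPf kj);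
       congr (_ *: _); rewrite /=; ring.
  by apply: spec_out => //; left; lra.
have eji : T j i v = 0.
  have := T_comm j k k i v; rewrite u1 u2 !T0 eqxx (eq_sym i) ji scale1r scale0r.
  by rewrite subr0 add0r.
have eij : T i j v = 0.
  apply: (@H_eig_eq0 i j 4); first by apply: spec_out => //; right; lra.
  by rewrite H_e // Ev TZ -scalerDl; congr (_ *: _); ring.
have := e_f v ij; rewrite eij eji !T0 add0r Ev => /esym/eqP.
by rewrite scaler_eq0 pnatr_eq0 (negPf v0).
Qed.

(* The weight of the square of the k-th coordinate form in Sym_2(E dual). *)
Definition sq (k i : 'I_3) : int := - 2 * (i == k)%:Z.

(** The eigenline of [H 0 2] for 2 is stable under [H 0 1], which acts by some z, while [H 1 2] acts
    by 2 - z. Both are at most 2, so z is 0, 1 or 2: weight -2 eps_2, the excluded root eps_0 -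
    eps_2, or 2 eps_0. *)
Lemma exists_square_weight : exists2 v, v != 0 &
  wt (fun i => 2 * (i == 0)%:Z) v \/ wt (sq 2) v.
Proof.
have /eigenvalueP[v] : eigenvalue (Hm 0 2) 2 by exact: exists_weight_2.
rewrite -HmE => Ev v0.
have [c cE] : exists c, H 0 1 v = c *: v.
  by apply: (@H_2_line 0 2) => //; rewrite H_comm Ev HZ.
have cE2 : H 1 2 v = (2 - c) *: v.
  by rewrite scalerBl -Ev -cE (H_chain 0 1 2) [RHS]addrC addKr.
have [//|z zE /andP[z1 z2]] := spec_int _ (H_eig_spec v0 cE).
have [//|y yE /andP[y1 y2]] := spec_int _ (H_eig_spec v0 cE2).
rewrite zE in cE; rewrite yE in cE2.
have yz : y = 2 - z by apply: (@intr_inj R); rewrite -yE zE rmorphB.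
exists v => //.
have : z \in [:: 0; 1; 2] by rewrite !inE; lia.
rewrite !inE => /or3P[]/eqP ze; rewrite ze in yz cE; rewrite yz in cE2.
- right; apply: wt_ext (wt_of_H cE cE2) => i j.
  by case: (ord3P i) => ->; case: (ord3P j) => ->.
- by move: v0; rewrite (@no_root_weight 0 2 1 v) ?eqxx.
- left; apply: wt_ext (wt_of_H cE cE2) => i j.
  by case: (ord3P i) => ->; case: (ord3P j) => ->.
Qed.

Lemma wt_uniq c c' w i j : wt c w -> wt c' w -> w != 0 -> c i - c j = c' i - c' j.
Proof.
move=> wc wc' w0; apply: (@intr_inj R); apply/eqP; rewrite -subr_eq0.
have /eqP := wc i j; rewrite (wc' i j) eq_sym -subr_eq0 -scalerBl scaler_eq0.
by rewrite (negPf w0) orbF.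
Qed.

Lemma act_wt X c w : \tr X = 0 -> wt c w -> w *m (rho X)^T =
  \sum_i \sum_j X i j *: (if i == j then (c i)%:~R *: w else T i j w).
Proof.
move=> X0 wc.
have -> : w *m (rho X)^T = \sum_i \sum_j X i j *: T i j w.
  rewrite -(gl_id X0) {1}[X]matrix_sum_delta (linear_sum gl) /= linear_sum /= mulmx_sumr.
  apply: eq_bigr => i _; rewrite (linear_sum gl) /= linear_sum /= mulmx_sumr.
  by apply: eq_bigr => j _; rewrite [gl _]linearZ [(_ *: _)^T]linearZ -scalemxAr TE.
(* The difference between E_ii w and c_i w is the same vector d for every i, so it enters with the
   factor tr X = 0. *)
pose d := T 0 0 w - (c 0)%:~R *: w.
have -> : \sum_i \sum_j X i j *: T i j w = \sum_i (X i i *: d +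
    \sum_j X i j *: (if i == j then (c i)%:~R *: w else T i j w)).
  apply: eq_bigr => i _; rewrite (bigD1 i) //= [in RHS](bigD1 i) //= eqxx addrA.
  congr (_ + _); last by apply: eq_bigr => j; rewrite eq_sym => /negPf->.
  rewrite -scalerDr; congr (_ *: _); rewrite /d.
  have /eqP := wc i 0; rewrite HE subr_eq => /eqP->.
  by rewrite rmorphB scalerBl addrC addrA addrAC -addrA.
by rewrite big_split /= -scaler_suml -/(\tr X) X0 scale0r add0r.
Qed.

(** * Decomposition of W when -2 eps_2 is a weight *)

Section SquareWeight.
Variable v2 : 'rV[R]_n.
Hypothesis v2_neq0 : v2 != 0.
Hypothesis v2_wt : wt (sq 2) v2.

(* The square of the i-th coordinate form, generated from that of the last one. *)
Definition sqvec i := locked (if i == 2 then v2 else 2^-1 *: T 2 i (T 2 i v2)).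

Lemma sqvecE i : sqvec i = if i == 2 then v2 else 2^-1 *: T 2 i (T 2 i v2).
Proof. by rewrite /sqvec -lock. Qed.

Lemma sqvec_wt i : wt (sq i) (sqvec i).
Proof.
rewrite sqvecE; case: eqP => [->//|_].
apply/wtZ/(wt_ext _ (wtT 2 i (wtT 2 i v2_wt))) => j k; rewrite /sq; ring.
Qed.

Lemma sqvec_neq0 i : sqvec i != 0.
Proof.
rewrite sqvecE; have [//|i2] := eqVneq i 2; rewrite scaler_eq0 invr_eq0 pnatr_eq0 /=.
apply: contraNneq v2_neq0 => /ee_inj->; rewrite // 1?eq_sym // v2_wt /sq eqxx (negPf i2).
by rewrite mulr1 mulr0 subr0 rmorphN.
Qed.

Lemma H_sqvec i j : i != j -> H i j (sqvec j) = 2 *: sqvec j.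
Proof.
by move=> ij; rewrite sqvec_wt /sq eqxx (negPf ij) mulr1 mulr0 sub0r opprK.
Qed.

Lemma ex_neq (i : 'I_3) : exists j, j != i.
Proof. by case: (ord3P i) => ->; [exists 1 | exists 0 | exists 0]. Qed.

Lemma weight_2 i j w : i != j -> H i j w = 2 *: w -> exists a, w = a *: sqvec j.
Proof. by move=> ij; exact: H_2_line ij (sqvec_neq0 j) (H_sqvec ij). Qed.

Lemma weight_sq i w : wt (sq i) w -> exists a, w = a *: sqvec i.
Proof.
have [j ji] := ex_neq i => wi; apply: (weight_2 ji).
by rewrite wi /sq eqxx (negPf ji) mulr1 mulr0 sub0r opprK.
Qed.

(** The eigenvalue 2 of [H i j] is simple and carried by [sqvec j], so this single value determines
    the whole weight. *)
Lemma wt_2 c i j w k l : i != j -> wt c w -> w != 0 -> c i - c j = 2 ->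
  c k - c l = sq j k - sq j l.
Proof.
move=> ij wc w0 c2; apply: (wt_uniq _ _ wc _ w0).
have [|a ->] := @weight_2 i j w ij; first by rewrite wc c2.
exact/wtZ/sqvec_wt.
Qed.

(** The invariant trilinear pairing of u, u' and w can be nonzero only if the three weights add up
    to zero. *)
Lemma wedge_pair c c' d u u' w i j : wt c u -> wt c' u' -> wt d w ->
  wedge u u' *m w^T != 0 -> d i - d j = (c j - c i) + (c' j - c' i).
Proof.
move=> cu cu' dw; apply: contraNeq => ne.
have := congr1 (mulmx^~ w^T) (H_wedge i j u u').
rewrite (cu i j) (cu' i j) wZl wZr -scalerDl mulNmx -scalemxAl -mulmxA -trmx_mul.
rewrite -HmE (dw i j) linearZ /= -scalemxAr -scaleNr => /eqP.
rewrite -subr_eq0 -scalerBl scaler_eq0 => /orP[|//].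
rewrite -rmorphN -rmorphD -rmorphB intr_eq0 => /eqP e0.
by case/eqP: ne; lia.
Qed.

Lemma functional_eq0 (f : 'rV[R]_n) :
  (forall c w, wt c w -> f *m w^T = 0) -> f = 0.
Proof.
move=> fw; have /row_fullP[B BK] : row_full (kermx f^T).
  apply: wt_span => c w /fw fw0 _; apply/sub_kermxP.
  by apply: trmx_inj; rewrite trmx_mul trmxK fw0 trmx0.
by apply: trmx_inj; rewrite -[LHS]mul1mx -BK -mulmxA mulmx_ker mulmx0 trmx0.
Qed.

(* u together with sqvec k would span an isotropic plane. *)
Lemma no_neg_weight k u : wt (fun i => - (i == k)%:Z) u -> u = 0.
Proof.
move=> uk; apply/eqP; apply: contraT => u0.
have [j jk] := ex_neq k; have kj : k != j by rewrite eq_sym.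
have [l lj lk] := third_index jk.
have Ev := H_sqvec jk.
have Eu : H j k u = 1 *: u by rewrite uk eqxx (negPf jk).
have [|||a uE] := @isotropic_colinear u (sqvec k) (sqvec_neq0 k).
- by apply: (wedge_eig_eq0 Ev Ev); apply: spec_out => //; left; lra.
- by apply: (wedge_eig_eq0 Ev Eu); apply: spec_out => //; left; lra.
(* A weight vector w pairing nontrivially with the square of u has weight 2 eps_k. Its value 2 on
   E_kk - E_jj would force the weight -2 eps_j by [wt_2], which takes 0 and not 2 on E_kk - E_ll. *)
- apply: functional_eq0 => d w dw; apply/eqP; apply: contraT => nz.
  have w0 : w != 0 by apply: contraNneq nz => ->; rewrite trmx0 mulmx0.
  have E p q := wedge_pair p q uk uk dw nz.
  have Ekj : d k - d j = 2 by rewrite E eqxx (negPf jk).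
  have Ekl : d k - d l = 2 by rewrite E eqxx (negPf lk).
  have := wt_2 k l kj dw w0 Ekj; rewrite Ekl /sq (negPf lj) (negPf kj).
  by [].
have := Eu; rewrite {1}uE HZ Ev scalerA mulrC -scalerA -uE => /eqP.
rewrite -subr_eq0 -scalerBl scaler_eq0 => /orP[|/eqP u00].
  by rewrite (_ : _ - _ = 1) ?oner_eq0 //; ring.
by rewrite u00 eqxx in u0.
Qed.

(** A difference equal to 2 is settled by [wt_2]. If all differences lie between -1 and 1, only
    eps_k, -eps_k and 0 remain, seven weights in all, and [no_neg_weight] removes -eps_k. *)
Lemma weights c w : wt c w -> w != 0 -> [\/ exists k, wt (sq k) w,
  exists k, wt (fun i => (i == k)%:Z) w | wt (fun=> 0) w].
Proof.
move=> wc w0.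
have [[i [j [ij c2]]]|n2] : (exists i j, i != j /\ c i - c j = 2) \/
    (forall i j, i != j -> c i - c j <> 2).
- case: (boolP [exists i, exists j, (i != j) && (c i - c j == 2)]).
    by move=> /existsP[i /existsP[j /andP[ij /eqP c2]]]; left; exists i, j.
  rewrite negb_exists => /forallP N; right => i j ij /eqP c2.
  by have := N i; rewrite negb_exists => /forallP/(_ j); rewrite ij c2.
- by apply: Or31; exists j; apply: (wt_ext _ wc) => k l; exact: (wt_2 _ _ ij wc w0 c2).
have B i j : i != j -> c i - c j <= 1.
  by move=> ij; have := wt_bound wc w0 ij; have := n2 i j ij; lia.
have neg k : (forall i j, c i - c j = - (i == k)%:Z - - (j == k)%:Z) -> False.
  move=> E; case/eqP: w0; apply: (@no_neg_weight k); exact: (wt_ext E wc).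
have pos k : (forall i j, c i - c j = (i == k)%:Z - (j == k)%:Z) -> 
   [\/ exists k, wt (sq k) w, exists k, wt (fun i => (i == k)%:Z) w | wt (fun=> 0) w].
  by move=> E; apply: Or32; exists k; exact: (wt_ext E wc).
have := (B 0 1 isT, B 1 0 isT, B 0 2 isT, B 2 0 isT, B 1 2 isT, B 2 1 isT).
case=> -[[[[B01 B10] B02] B20] B12] B21.
have [a aE] : exists a, a = c 0 - c 1 by exists (c 0 - c 1).
have [b bE] : exists b, b = c 1 - c 2 by exists (c 1 - c 2).
have [Ba Bb Bab] : [/\ -1 <= a <= 1, -1 <= b <= 1 & -1 <= a + b <= 1].
  rewrite aE bE; move: B01 B10 B02 B20 B12 B21.
  by move: (c 0) (c 1) (c 2) => x y z *; split; lia.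
have c1E : c 1 = c 2 + b by rewrite bE; ring.
have c0E : c 0 = c 2 + a + b by rewrite aE bE; ring.
clear B01 B10 B02 B20 B12 B21 aE bE.
have all3 (P : 'I_3 -> 'I_3 -> Prop) : P 0 0 -> P 0 1 -> P 0 2 -> P 1 0 -> P 1 1 ->
   P 1 2 -> P 2 0 -> P 2 1 -> P 2 2 -> forall i j, P i j.
  by move=> ? ? ? ? ? ? ? ? ? i j; case: (ord3P i) => ->; case: (ord3P j) => ->.
have : [\/ [\/ a = 1 /\ b = 0, a = -1 /\ b = 1 | a = 0 /\ b = -1],
   [\/ a = -1 /\ b = 0, a = 1 /\ b = -1 | a = 0 /\ b = 1] | a = 0 /\ b = 0].
  have [e | [e | e]] : a = 0 \/ a = 1 \/ a = -1 by lia.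
  + rewrite e in Bab *; have [-> | [-> | ->]] : b = 0 \/ b = 1 \/ b = -1 by lia.
    * by apply: Or33. * by apply: Or32; apply: Or33. * by apply: Or31; apply: Or33.
  + rewrite e in Bab *; have [-> | ->] : b = 0 \/ b = -1 by lia.
    * by apply: Or31; apply: Or31. * by apply: Or32; apply: Or32.
  + rewrite e in Bab *; have [-> | ->] : b = 0 \/ b = 1 by lia.
    * by apply: Or32; apply: Or31. * by apply: Or31; apply: Or32.
case=> [[]|[]|] [a0 b0].
- by apply: (pos 0); apply: all3; rewrite ?c0E ?c1E ?a0 ?b0 /=; move: (c 2) => x; lia.
- by apply: (pos 1); apply: all3; rewrite ?c0E ?c1E ?a0 ?b0 /=; move: (c 2) => x; lia.
- by apply: (pos 2); apply: all3; rewrite ?c0E ?c1E ?a0 ?b0 /=; move: (c 2) => x; lia.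
- by case: (neg 0); apply: all3; rewrite ?c0E ?c1E ?a0 ?b0 /=; move: (c 2) => x; lia.
- by case: (neg 1); apply: all3; rewrite ?c0E ?c1E ?a0 ?b0 /=; move: (c 2) => x; lia.
- by case: (neg 2); apply: all3; rewrite ?c0E ?c1E ?a0 ?b0 /=; move: (c 2) => x; lia.
- apply: Or33; apply: (wt_ext _ wc).
  by apply: all3; rewrite ?c0E ?c1E ?a0 ?b0 /=; move: (c 2) => x; lia.
Qed.

(** The weight -2 eps_i + eps_k - eps_l takes a value of at least 3 on E_kk - E_ii. *)
Lemma T_sqvec_eq0 k l i : k != l -> k != i -> T k l (sqvec i) = 0.
Proof.
move=> kl ki; apply: (wt_out (wtT k l (sqvec_wt i)) ki).
rewrite /sq !eqxx (negPf kl) (negPf ki) (eq_sym i) (negPf ki).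
by case: (i == l).
Qed.

Lemma T_ep_eq0 i l w : l != i -> wt (fun j => (j == i)%:Z) w -> T i l w = 0.
Proof.
move=> li wi; apply: (wt_out (wtT i l wi)); first by rewrite eq_sym; exact: li.
by rewrite !eqxx (negPf li) eq_sym (negPf li).
Qed.

(** The weight eps_k - eps_l takes 2 on E_kk - E_ll but differs from -2 eps_l. *)
Lemma T_wt0_eq0 k l w : k != l -> wt (fun=> 0) w -> T k l w = 0.
Proof.
move=> kl w0; apply/eqP; apply: contraT => nz; have [m mk ml] := third_index kl.
have wT := wtT k l w0; have lk : (l == k) = false by rewrite eq_sym (negPf kl).
have := wt_2 k m kl wT nz.
by rewrite /sq !eqxx (negPf kl) lk (negPf mk) (negPf ml) => /(_ erefl).
Qed.

(** Corresponds to 2 x_a x_b for the coordinate forms x_a, since E_ab sends the square of x_a to -2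
    x_a x_b. *)
Definition symvec a b := locked (if a == b then 2 *: sqvec a else - T a b (sqvec a)).

Lemma symvecE a b : symvec a b = if a == b then 2 *: sqvec a else - T a b (sqvec a).
Proof. by rewrite /symvec -lock. Qed.

Lemma symvec_diag a : symvec a a = 2 *: sqvec a. Proof. by rewrite symvecE eqxx. Qed.
Lemma symvec_off a b : a != b -> symvec a b = - T a b (sqvec a).
Proof. by rewrite symvecE => /negPf->. Qed.

(* The relations of Sym_2(E dual) all follow from the symmetry of T a b (sqvec a)
   in a and b, which is T_sqvec_sym. *)
Lemma T_sqvec_sym2 j : j != 2 -> T j 2 (sqvec j) = T 2 j (sqvec 2).
Proof.
move=> j2; have j2' : 2 != j by rewrite eq_sym.
have vvj : sqvec j = 2^-1 *: T 2 j (T 2 j v2) by rewrite sqvecE (negPf j2).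
have v22 : sqvec 2 = v2 by rewrite sqvecE.
rewrite vvj v22 TZ (e_f (T 2 j v2) j2) (e_f v2 j2).
have -> : T j 2 v2 = 0 by rewrite -v22; exact: T_sqvec_eq0.
have Hv : H j 2 v2 = 2 *: v2 by rewrite -v22; exact: H_sqvec.
rewrite T0 add0r Hv H_f // Hv TZ subrr addr0 scalerA mulVf ?scale1r //.
by rewrite pnatr_eq0.
Qed.

(** The right-hand side is symmetric in k and l because E_2k and E_2l commute. *)
Lemma T_sqvec_sym01 k l : k != l -> k != 2 -> l != 2 ->
  T k l (sqvec k) = - T 2 l (T 2 k v2).
Proof.
move=> kl k2 l2; have v22 : sqvec 2 = v2 by rewrite sqvecE.
have -> : sqvec k = 2^-1 *: T 2 k (T 2 k v2) by rewrite sqvecE (negPf k2).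
have E w : T k l (T 2 k w) = T 2 k (T k l w) - T 2 l w.
  by rewrite T_comm eqxx (negPf l2) scale0r addr0 scale1r.
have E0 : T k l v2 = 0 by rewrite -v22; exact: T_sqvec_eq0.
have C : T 2 k (T 2 l v2) = T 2 l (T 2 k v2).
  by rewrite T_comm (negPf k2) (negPf l2) !scale0r addr0 subr0.
rewrite TZ E E E0 T0 sub0r TN C -opprD scalerN; congr (- _).
by rewrite -mulr2n -scaler_nat scalerA mulVf ?scale1r // pnatr_eq0.
Qed.

Lemma T_sqvec_sym a b : a != b -> T a b (sqvec a) = T b a (sqvec b).
Proof.
move=> ab; have ba : b != a by rewrite eq_sym.
have [a2|a2] := eqVneq a 2; first by rewrite a2 in ba *; rewrite T_sqvec_sym2.
have [b2|b2] := eqVneq b 2; first by rewrite b2 in ab *; rewrite T_sqvec_sym2.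
rewrite (T_sqvec_sym01 ab a2 b2) (T_sqvec_sym01 ba b2 a2); congr (- _).
by rewrite T_comm (negPf a2) (negPf b2) !scale0r addr0 subr0.
Qed.

Lemma symvec_sym a b : symvec a b = symvec b a.
Proof.
have [->//|ab] := eqVneq a b.
have ba : b != a by rewrite eq_sym.
by rewrite (symvec_off ab) (symvec_off ba) (T_sqvec_sym ab).
Qed.

Lemma symvec_wt a b : wt (fun i => - (i == a)%:Z - (i == b)%:Z) (symvec a b).
Proof.
have [->|ab] := eqVneq a b.
  rewrite symvec_diag; apply/wtZ/(wt_ext _ (sqvec_wt b)) => i j; rewrite /sq; ring.
rewrite (symvec_off ab); apply/wtN/(wt_ext _ (wtT a b (sqvec_wt a))) => i j; rewrite /sq; ring.
Qed.

Lemma symvec_T1 a b j : a != j -> b != a -> T a j (symvec a b) = - symvec j b.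
Proof.
move=> aj ba; have ab : a != b by rewrite eq_sym.
rewrite (symvec_off ab) (T_sqvec_sym ab) TN; congr (- _).
have [jb|jb] := eqVneq j b.
  rewrite jb symvec_diag (e_f _ ab) (T_sqvec_eq0 ab ab) T0 add0r; exact: H_sqvec.
have bj : b != j by rewrite eq_sym.
rewrite T_comm (negPf jb) eqxx scale0r addr0 scale1r (T_sqvec_eq0 aj ab) T0 sub0r.
by rewrite -(symvec_off bj) symvec_sym.
Qed.

Lemma symvec_T i j a b : i != j ->
  T i j (symvec a b) = - (a == i)%:R *: symvec j b - (b == i)%:R *: symvec a j.
Proof.
move=> ij; have [ab|ab] := eqVneq a b.
  rewrite -ab symvec_diag TZ; have [ai|ai] := eqVneq a i; last first.
    by rewrite (T_sqvec_eq0 ij) 1?eq_sym // oppr0 !scale0r scaler0 subr0.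
  rewrite ai (symvec_sym j) (symvec_off ij) scaleNr !scale1r opprK scaler_nat mulr2n.
  by [].
have [ai|ai] := eqVneq a i.
  have ba : b != a by rewrite eq_sym.
  rewrite -ai in ij *; rewrite (symvec_T1 ij ba).
  by rewrite eq_sym (negPf ab) scale0r subr0 scaleNr scale1r.
rewrite oppr0 scale0r sub0r; have [bi|bi] := eqVneq b i.
  by rewrite -bi in ij *; rewrite symvec_sym (symvec_T1 ij ab) scale1r symvec_sym.
rewrite scale0r oppr0; have [ja|ja] := eqVneq j a.
  rewrite ja in ij *; rewrite (symvec_off ab) (T_sqvec_sym ab) TN.
  apply/eqP; rewrite oppr_eq0; apply/eqP.
  have ib : i != b by rewrite eq_sym.
  by rewrite T_comm (negPf ab) (negPf ai) !scale0r addr0 subr0 (T_sqvec_eq0 ij ib) T0.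
have [jb|jb] := eqVneq j b.
  have ia : i != a by rewrite eq_sym.
  rewrite jb in ij *; rewrite (symvec_off ab) TN.
  apply/eqP; rewrite oppr_eq0; apply/eqP.
  by rewrite T_comm (eq_sym b a) (negPf ab) (negPf bi) !scale0r addr0 subr0 (T_sqvec_eq0 ij ia) T0.
(* Four pairwise distinct indices among three. *)
exfalso; move: ab ij ai bi ja jb; clear.
by case: (ord3P a) => ->; case: (ord3P b) => ->; case: (ord3P i) => ->; case: (ord3P j) => ->.
Qed.

Lemma T_sqvec i j a : i != j -> T i j (sqvec a) = - (a == i)%:R *: symvec a j.
Proof.
move=> ij; have [ai|ai] := eqVneq a i.
  by rewrite ai (symvec_off ij) scaleNr scale1r opprK.
have ia : i != a by rewrite eq_sym.
by rewrite oppr0 scale0r (T_sqvec_eq0 ij ia).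
Qed.

(* The i-th basis vector of the copy of E generated by its highest weight vector x. *)
Definition stdvec i x := locked (if i == 0 then x else T i 0 x).

Lemma stdvecE i x : stdvec i x = if i == 0 then x else T i 0 x.
Proof. by rewrite /stdvec -lock. Qed.

(** Since eps_0 = -eps_1 - eps_2 as a weight, [symvec 1 2] has weight eps_0 too; it is not killed by
    E_12, so these conditions separate the copies of E from Sym_2(E dual). *)
Definition in_K x := [/\ wt (fun i => (i == 0)%:Z) x, T 1 2 x = 0 & T 2 1 x = 0].

Lemma stdvec_wt i x : in_K x -> wt (fun j => (j == i)%:Z) (stdvec i x).
Proof.
case=> x0 _ _; rewrite stdvecE; case: eqP => [->//|_].
by apply: (wt_ext _ (wtT i 0 x0)) => j k; ring.
Qed.

Lemma T_K_eq0 i j x : in_K x -> i != j -> j != 0 -> T i j x = 0.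
Proof.
case=> x0 x12 x21; case: (ord3P i) => ->; case: (ord3P j) => -> // ij j0.
- exact: T_ep_eq0.
- exact: T_ep_eq0.
Qed.

Lemma stdvec_T i j a x : in_K x -> i != j -> T i j (stdvec a x) = (j == a)%:R *: stdvec i x.
Proof.
move=> xK ij; have xT k l := T_K_eq0 (i := k) (j := l) xK.
have [ia|ia] := eqVneq i a.
  rewrite -ia eq_sym (negPf ij) scale0r; apply: T_ep_eq0; last exact: stdvec_wt.
  by rewrite eq_sym.
have [ja|ja] := eqVneq j a.
  rewrite ja scale1r !stdvecE; have [a0|a0] := eqVneq a 0.
    by rewrite a0 in ia *; rewrite (negPf ia).
  rewrite ja in ij; have [i0|i0] := eqVneq i 0.
    rewrite i0 in ij *; rewrite e_f // xT // T0 add0r.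
    by case: xK => x0 _ _; rewrite x0 eqxx (negPf a0) subr0 scale1r.
  by rewrite T_comm eqxx (eq_sym 0) (negPf i0) scale0r subr0 scale1r xT // T0 add0r.
rewrite scale0r stdvecE; have [a0|a0] := eqVneq a 0.
  by rewrite a0 in ja; exact: xT.
have [j0|j0] := eqVneq j 0; last first.
  rewrite T_comm (negPf ja) xT // T0 scale0r add0r sub0r xT ?scaler0 ?oppr0 //.
  by rewrite eq_sym.
(* A vector of weight -2 eps_0 killed by e = T 0 i, hence zero. *)
rewrite j0 in ij ja *; have i0 : 0 != i by rewrite eq_sym.
set y := T a 0 x; have yE : y = stdvec a x by rewrite /y stdvecE (negPf a0).
have yw := stdvec_wt a xK; rewrite -yE in yw.
apply: (ee_inj i0).
  by rewrite (wtT i 0 yw) !eqxx (negPf ij) (negPf ia) (negPf ja) (eq_sym 0) (negPf ij).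
rewrite e_f //.
have -> : T 0 i y = 0.
  rewrite /y T_comm (negPf ia) eqxx scale0r addr0 scale1r xT // T0 sub0r xT ?oppr0 //.
  by rewrite eq_sym.
by rewrite yw (negPf ja) (negPf ia) subrr scale0r T0 add0r T0.
Qed.

(** E_12 w has weight -2 eps_2, so it lies on the line of [sqvec 2], which E_12 also reaches from
    [symvec 1 2]; a multiple of the latter corrects w. *)
Lemma ep0_decomp w : wt (fun i => (i == 0)%:Z) w ->
  exists a x, w = a *: symvec 1 2 + x /\ in_K x.
Proof.
move=> w0.
have [c cE] : exists c, T 1 2 w = c *: sqvec 2.
  apply: weight_sq; apply: (wt_ext _ (wtT 1 2 w0)) => i j; rewrite /sq.
  by case: (ord3P i) => ->; case: (ord3P j) => ->.
have s12 : T 1 2 (symvec 1 2) = - 2 *: sqvec 2.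
  by rewrite (@symvec_T1 1 2 2) // symvec_diag scaleNr.
have sw : wt (fun i => (i == 0)%:Z) (symvec 1 2).
  apply: (wt_ext _ (symvec_wt 1 2)) => i j.
  by case: (ord3P i) => ->; case: (ord3P j) => ->.
pose x := w - (- c / 2) *: symvec 1 2.
have xw : wt (fun i => (i == 0)%:Z) x by apply: wtB w0 (wtZ _ sw).
have x12 : T 1 2 x = 0.
  rewrite /x TB TZ s12 cE scalerA -scalerBl (_ : _ - _ = 0) ?scale0r //; lra.
exists (- c / 2), x; split; first by rewrite addrC subrK.
split => //; have n12 : (1 : 'I_3) != 2 by [].
(* E_21 x has weight -2 eps_1, and E_12 E_21 x = 0 since both E_12 and E_11 - E_22 kill x. *)
apply: (ee_inj n12); first by rewrite (wtT 2 1 xw).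
by rewrite (e_f _ n12) x12 T0 add0r xw subrr scale0r T0.
Qed.

(** Reduces to weight eps_0, because E_i0 E_0i is the identity on vectors of weight eps_i. *)
Lemma ep_decomp i w : wt (fun j => (j == i)%:Z) w ->
  exists a b c x, [/\ w = a *: symvec 0 1 + b *: symvec 0 2 + c *: symvec 1 2 + stdvec i x
    & in_K x].
Proof.
move=> wi; have [i0|i0] := eqVneq i 0.
  rewrite i0 in wi *; have [a [x [-> xK]]] := ep0_decomp wi.
  by exists 0, 0, a, x; split => //; rewrite stdvecE !scale0r !add0r.
have i0' : 0 != i by rewrite eq_sym.
have [|a [x [E xK]]] := @ep0_decomp (T 0 i w).
  by apply: (wt_ext _ (wtT 0 i wi)) => j k; ring.
have wTT : w = T i 0 (T 0 i w).
  rewrite (e_f _ i0) (T_ep_eq0 i0' wi) T0 add0r wi eqxx (negPf i0').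
  by rewrite subr0 scale1r.
(* E_i0 sends [symvec 1 2] to - [symvec 0 2] for i = 1 and to - [symvec 1 0] for i = 2. *)
exists (if i == 2 then - a else 0), (if i == 1 then - a else 0), 0, x.
split=> //; rewrite {1}wTT E TD TZ (symvec_T _ _ i0) stdvecE (negPf i0) scale0r addr0.
congr (_ + _); rewrite (eq_sym 1) (eq_sym 2) (symvec_sym 1 0).
by case: (ord3P i) => -> /=; rewrite ?(oppr0, scaler0, scale0r, scale1r,
  sub0r, add0r, addr0, subr0, scaleNr, scalerN) //.
Qed.

Lemma weights_indep s0 s1 s2 s3 s4 s5 x0 x1 x2 z :
    in_K x0 -> in_K x1 -> in_K x2 -> wt (fun=> 0) z ->
    s0 *: sqvec 0 + s1 *: sqvec 1 + s2 *: sqvec 2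
     + s3 *: symvec 0 1 + s4 *: symvec 0 2 + s5 *: symvec 1 2
     + (stdvec 0 x0 + stdvec 1 x1 + stdvec 2 x2) + z = 0 ->
  [/\ [/\ s0 = 0, s1 = 0 & s2 = 0], [/\ s3 = 0, s4 = 0 & s5 = 0],
      [/\ x0 = 0, x1 = 0 & x2 = 0] & z = 0].
Proof.
move=> K0 K1 K2 z0 E.
pose x (b : 'I_3) := if b == 0 then x0 else if b == 1 then x1 else x2 : 'rV[R]_n.
have xK b : in_K (x b) by rewrite /x; case: ifP => // _; case: ifP.
have [|||||||||] := @sym_std_triv_indep R _ T sqvec symvec (fun a b => stdvec a (x b)) z
  s0 s1 s2 s3 s4 s5.
- exact: TD.
- exact: TZ.
- exact: T_sqvec.
- exact: symvec_T.
- exact: symvec_diag.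
- by move=> i j a b ij; exact: stdvec_T.
- by move=> i j ij; exact: T_wt0_eq0.
- exact: sqvec_neq0.
- exact: E.
rewrite !stdvecE /x /= => s012 s345 [X1 X2]; rewrite X1 X2 !T0 !addr0 => E0.
(* [H 0 1] separates x0, of eigenvalue 1, from z, of eigenvalue 0. *)
have X0 : x0 = 0.
  have [w0 _ _] := K0.
  have := congr1 (H 0 1) E0; rewrite HD w0 z0 H0 subrr scale0r addr0.
  by rewrite subr0 scale1r.
by split=> //; rewrite X0 add0r in E0.
Qed.

(** The space of vectors satisfying [in_K]; its dimension is the number k of copies of E. *)
Definition std_mult := kermx (row_mx (Hm 0 1 - 1%:M) (row_mx (Hm 1 2) (row_mx (M 1 2) (M 2 1)))).
Definition std_mult_basis := row_base std_mult.
Definition triv_basis := row_base (kermx (row_mx (Hm 0 1) (Hm 1 2))).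

Lemma row_mx_eq0 p q r (A : 'M[R]_(p, q)) (B : 'M[R]_(p, r)) :
  row_mx A B = 0 <-> A = 0 /\ B = 0.
Proof.
split=> [|[-> ->]]; last exact: row_mx0.
by rewrite -[0](row_mx0 R p q r) => /eq_row_mx.
Qed.

Lemma sub_KmxP x : (x <= std_mult)%MS <-> in_K x.
Proof.
have [S1 S2] : ((x <= std_mult)%MS -> x *m (row_mx (Hm 0 1 - 1%:M) (row_mx (Hm 1 2)
    (row_mx (M 1 2) (M 2 1)))) = 0) /\ (x *m (row_mx (Hm 0 1 - 1%:M) (row_mx (Hm 1 2)
    (row_mx (M 1 2) (M 2 1)))) = 0 -> (x <= std_mult)%MS).
  by split => /sub_kermxP.
split=> [/S1|[x0 x12 x21]]; last apply: S2.
  rewrite !mul_mx_row !row_mx_eq0 mulmxBr mulmx1 -HmE -HmE -!TE => -[h01 [h12 [x12 x21]]].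
  split=> //; have E1 : H 0 1 x = 1%:~R *: x.
    by apply/eqP; rewrite scale1r -subr_eq0 h01.
  have E2 : H 1 2 x = 0%:~R *: x by rewrite scale0r.
  apply: (wt_ext _ (wt_of_H E1 E2)) => i j.
  by case: (ord3P i) => ->; case: (ord3P j) => ->.
rewrite !mul_mx_row !row_mx_eq0 mulmxBr mulmx1 -HmE -HmE -!TE x12 x21 !x0 /=.
by rewrite !subr0 scale1r scale0r subrr.
Qed.

Lemma in_K_row a : in_K (row a std_mult_basis).
Proof.
by apply/sub_KmxP; rewrite -(eq_row_base std_mult); exact: row_sub.
Qed.

Lemma sub_ZBP w : (w <= triv_basis)%MS <-> wt (fun=> 0) w.
Proof.
rewrite /triv_basis eq_row_base; split=> [/sub_kermxP|w0].
  rewrite mul_mx_row row_mx_eq0 -!HmE => -[h01 h12].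
  have E1 : H 0 1 w = 0%:~R *: w by rewrite scale0r.
  have E2 : H 1 2 w = 0%:~R *: w by rewrite scale0r.
  apply: (wt_ext _ (wt_of_H E1 E2)) => i j.
  by case: (ord3P i) => ->; case: (ord3P j) => ->.
by apply/sub_kermxP; rewrite mul_mx_row row_mx_eq0 -!HmE !w0 !subrr !scale0r.
Qed.

(** * The basis of W adapted to the model, and the action on it *)

Definition sym_coord_vec (l : 'I_6) := if p1 l == p2 l then sqvec (p1 l) else symvec (p1 l) (p2 l).
Definition sym_basis : 'M[R]_(6, n) := \matrix_(l < 6) sym_coord_vec l.
Definition std_basis : 'M[R]_(3 * \rank std_mult, n) :=
  \matrix_(y < 3 * \rank std_mult) stdvec (copy_of y).2 (row (copy_of y).1 std_mult_basis).
Definition model_basis := col_mx sym_basis (col_mx std_basis triv_basis).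

Lemma row_std_basis a i : row (copy_idx (a, i)) std_basis = stdvec i (row a std_mult_basis).
Proof. by rewrite rowK copy_idxK. Qed.

Lemma stdvecD i u v : stdvec i (u + v) = stdvec i u + stdvec i v.
Proof. by rewrite !stdvecE; case: ifP => _ //; rewrite TD. Qed.
Lemma stdvecZ i a u : stdvec i (a *: u) = a *: stdvec i u.
Proof. by rewrite !stdvecE; case: ifP => _ //; rewrite TZ. Qed.
Lemma stdvec_sum i (I : Type) (r : seq I) (F : I -> 'rV[R]_n) :
  stdvec i (\sum_(a <- r) F a) = \sum_(a <- r) stdvec i (F a).
Proof.
apply: (big_morph (stdvec i)) => [u v|]; first exact: stdvecD.
by rewrite -(scale0r 0) stdvecZ !scale0r.
Qed.

Lemma mul_rV_sum p (u : 'rV[R]_p) (A : 'M[R]_(p, n)) :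
  u *m A = \sum_a u 0 a *: row a A.
Proof. exact: mulmx_sum_row. Qed.

Lemma submx_col_l p q (A : 'M[R]_(p, n)) (B : 'M[R]_(q, n)) : (A <= col_mx A B)%MS.
Proof. by rewrite -addsmxE addsmxSl. Qed.
Lemma submx_col_r p q (A : 'M[R]_(p, n)) (B : 'M[R]_(q, n)) : (B <= col_mx A B)%MS.
Proof. by rewrite -addsmxE addsmxSr. Qed.

Lemma sym_coord_vec_sub l : (sym_coord_vec l <= model_basis)%MS.
Proof.
apply: (submx_trans _ (_ : (sym_basis <= model_basis)%MS)); last exact: submx_col_l.
by rewrite -(rowK sym_coord_vec l) row_sub.
Qed.

Lemma sqvec_sub a : (sqvec a <= model_basis)%MS.
Proof.
have [[a0 a1 a2] _ [b0 b1 b2] _] := p12E.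
case: (ord3P a) => ->;
  [have := sym_coord_vec_sub 0 | have := sym_coord_vec_sub 1 | have := sym_coord_vec_sub 2];
  by rewrite /sym_coord_vec ?a0 ?a1 ?a2 ?b0 ?b1 ?b2 eqxx.
Qed.

Lemma symvec_sub : [/\ (symvec 0 1 <= model_basis)%MS, (symvec 0 2 <= model_basis)%MS
  & (symvec 1 2 <= model_basis)%MS].
Proof.
have [_ [a3 a4 a5] _ [b3 b4 b5]] := p12E.
by split; [have := sym_coord_vec_sub 3 | have := sym_coord_vec_sub 4 | have := sym_coord_vec_sub 5];
  rewrite /sym_coord_vec ?a3 ?a4 ?a5 ?b3 ?b4 ?b5.
Qed.

Lemma stdvec_sub i x : in_K x -> (stdvec i x <= model_basis)%MS.
Proof.
move=> /sub_KmxP; rewrite -(eq_row_base std_mult) => /submxP[u ->].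
apply: (submx_trans _ (_ : (std_basis <= model_basis)%MS)); last first.
  exact: submx_trans (submx_col_l _ _) (submx_col_r _ _).
rewrite mul_rV_sum stdvec_sum; apply: summx_sub => a _; rewrite stdvecZ.
by apply: scalemx_sub; rewrite -row_std_basis row_sub.
Qed.

Lemma model_basis_full : row_full model_basis.
Proof.
apply: wt_span => c w wc w0; have [s01 s02 s12] := symvec_sub.
have [[k wk]|[k wk]|w00] := weights wc w0.
- by have [a ->] := weight_sq wk; apply: scalemx_sub; exact: sqvec_sub.
- have [a [b [d [x [-> xK]]]]] := ep_decomp wk.
  apply: addmx_sub (stdvec_sub _ xK); apply: addmx_sub (scalemx_sub _ s12).
  exact: addmx_sub (scalemx_sub _ s01) (scalemx_sub _ s02).
- apply: (submx_trans _ (_ : (triv_basis <= model_basis)%MS)); first exact/sub_ZBP.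
  exact: submx_trans (submx_col_r _ _) (submx_col_r _ _).
Qed.

Lemma in_K_sum (u : 'rV[R]_(\rank std_mult)) : in_K (u *m std_mult_basis).
Proof. by apply/sub_KmxP; rewrite -(eq_row_base std_mult) submxMl. Qed.

Lemma model_basis_free : row_free model_basis.
Proof.
apply: inj_row_free => v vQ.
have [[a0 a1 a2] [a3 a4 a5] [b0 b1 b2] [b3 b4 b5]] := p12E.
rewrite -[v]hsubmxK in vQ *; move: (lsubmx v) (rsubmx v) vQ => s t.
rewrite -[t]hsubmxK; move: (lsubmx t) (rsubmx t) => y z.
rewrite !mul_row_col => E.
(* For fixed i the copies are merged into one vector of [in_K], the shape needed by
   [weights_indep]. *)
pose u i : 'rV[R]_(\rank std_mult) := \row_a y 0 (copy_idx (a, i)).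
have yE : y *m std_basis = stdvec 0 (u 0 *m std_mult_basis)
    + stdvec 1 (u 1 *m std_mult_basis) + stdvec 2 (u 2 *m std_mult_basis).
  rewrite [LHS]mul_rV_sum sum_copy exchange_big /= big_ord3 !(mul_rV_sum (u _)) !stdvec_sum.
  by congr (_ + _ + _); apply: eq_bigr => a _; rewrite stdvecZ row_std_basis !mxE.
have sE : s *m sym_basis = s 0 0 *: sqvec 0 + s 0 1 *: sqvec 1 + s 0 2 *: sqvec 2 +
    s 0 3 *: symvec 0 1 + s 0 4 *: symvec 0 2 + s 0 5 *: symvec 1 2.
  rewrite mul_rV_sum big_ord6 !rowK /sym_coord_vec.
  by rewrite !(a0, a1, a2, a3, a4, a5) !(b0, b1, b2, b3, b4, b5).
have zW : wt (fun=> 0) (z *m triv_basis) by apply/sub_ZBP; exact: submxMl.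
rewrite yE sE addrA in E.
have [[e0 e1 e2] [e3 e4 e5] [x0 x1 x2] z0] :=
  weights_indep (in_K_sum _) (in_K_sum _) (in_K_sum _) zW E.
have u0 i : u i = 0.
  have : u i *m std_mult_basis = 0 by case: (ord3P i) => ->.
  move=> uK; apply: (row_free_inj (row_base_free std_mult)).
  by rewrite mul0mx.
have -> : s = 0.
  by apply/rowP => l; rewrite mxE; case: (ord6P l) => [[]||[]] ->.
have -> : y = 0.
  apply/rowP => l; rewrite mxE -(copy_ofK l); case: (copy_of l) => a i.
  by have /rowP/(_ a) := u0 i; rewrite !mxE.
have -> : z = 0.
  by apply: (row_free_inj (row_base_free _)); rewrite mul0mx; exact: z0.
by rewrite !row_mx0.
Qed.

(** On the diagonal the weight -eps_a - eps_b gives the same expression as [symvec_T] off it, so X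
    acts as the derivation sending x_a to the sum of the -X_aj x_j. *)
Lemma act_symvec X a b : \tr X = 0 -> symvec a b *m (rho X)^T =
  \sum_j (- X a j) *: symvec j b + \sum_j (- X b j) *: symvec a j.
Proof.
move=> X0; rewrite (act_wt X0 (symvec_wt a b)).
have E i j : (if i == j then (- (i == a)%:Z - (i == b)%:Z)%:~R *: symvec a b
    else T i j (symvec a b)) = - (a == i)%:R *: symvec j b - (b == i)%:R *: symvec a j.
  case: eqVneq => [<-|ij]; last exact: symvec_T.
  have -> : (- (i == a)%:Z - (i == b)%:Z)%:~R = - (a == i)%:R - (b == i)%:R :> R.
    by rewrite (eq_sym a) (eq_sym b) [LHS]rmorphB; congr (_ - _); exact: rmorphN.
  have A : (a == i)%:R *: symvec i b = (a == i)%:R *: symvec a b.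
    by have [->|_] := eqVneq a i; [exact: erefl | rewrite !scale0r].
  have B : (b == i)%:R *: symvec a i = (b == i)%:R *: symvec a b.
    by have [->|_] := eqVneq b i; [exact: erefl | rewrite !scale0r].
  rewrite B [in RHS]scaleNr A -[in RHS]scaleNr; exact: scalerBl.
under eq_bigr => i _ do under eq_bigr => j _ do rewrite E scalerDr.
under eq_bigr => i _ do rewrite big_split /=.
rewrite big_split /=; congr (_ + _).
  rewrite (bigD1 a) //= [X in _ + X]big1 ?addr0 => [|i /negPf ia].
    by apply: eq_bigr => j _; rewrite eqxx scalerA mulrN mulr1.
  by rewrite big1 // => j _; rewrite eq_sym ia oppr0 scale0r scaler0.
rewrite (bigD1 b) //= [X in _ + X]big1 ?addr0 => [|i /negPf ib].
  by apply: eq_bigr => j _; rewrite eqxx scale1r scalerN scaleNr.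
by rewrite big1 // => j _; rewrite eq_sym ib scale0r oppr0 scaler0.
Qed.

Lemma act_stdvec X j x : \tr X = 0 -> in_K x ->
  stdvec j x *m (rho X)^T = \sum_i X i j *: stdvec i x.
Proof.
move=> X0 xK; rewrite (act_wt X0 (stdvec_wt j xK)).
apply: eq_bigr => i _; rewrite (bigD1 j) //= [X in _ + X]big1 ?addr0.
  congr (_ *: _); case: eqVneq => [->|ij]; first by rewrite ?eqxx scale1r.
  by rewrite stdvec_T // eqxx scale1r.
move=> l /negPf lj; case: eqVneq => [->|il]; first by rewrite lj scale0r scaler0.
by rewrite stdvec_T // lj scale0r scaler0.
Qed.

Lemma act_sym_basis X : \tr X = 0 -> sym_basis *m (rho X)^T = (sym2dual_rep X)^T *m sym_basis.
Proof.
move=> X0; apply/row_matrixP => l; rewrite !row_mul rowK [RHS]mul_rV_sum.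
pose D : 'M[R]_3 := symmat (delta_mx l 0).
have DC a b : D a b = D b a by rewrite !mxE sym_idxC.
(* The action is computed on full double sums, where [sym_action] applies, and then folded back to
   six coordinates by [sym_sum]. *)
have -> : sym_coord_vec l = 2^-1 *: \sum_a \sum_b D a b *: symvec a b.
  rewrite -(@sym_sum _ _ symvec sqvec D DC symvec_sym symvec_diag) (bigD1 l) //= big1 => [|k kl].
    by rewrite addr0 !mxE sym_idxK !eqxx scale1r.
  by rewrite !mxE sym_idxK (negPf kl) scale0r.
pose N : 'M[R]_3 := - (D *m X + X^T *m D).
have NC a b : N a b = N b a.
  have : N^T = N.
    have Dt : D^T = D by apply/matrixP => i j; rewrite mxE DC.
    by rewrite /N linearN linearD /= !trmx_mul trmxK Dt addrC.
  by move=> /matrixP/(_ b a); rewrite mxE.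
transitivity (2^-1 *: \sum_a \sum_b N a b *: symvec a b).
  rewrite -scalemxAl mulmx_suml; congr (_ *: _).
  rewrite -sym_action; apply: eq_bigr => a _; rewrite mulmx_suml.
  by apply: eq_bigr => b _; rewrite -scalemxAl act_symvec.
rewrite -(@sym_sum _ _ symvec sqvec N NC symvec_sym symvec_diag).
by apply: eq_bigr => k _; rewrite rowK !mxE.
Qed.

Lemma act_std_basis X : \tr X = 0 ->
  std_basis *m (rho X)^T = (stdk_rep (\rank std_mult) X)^T *m std_basis.
Proof.
move=> X0; apply/row_matrixP => y; rewrite -(copy_ofK y); case: (copy_of y) => a j.
rewrite !row_mul row_std_basis (act_stdvec _ X0 (in_K_row a)) mul_rV_sum sum_copy.
rewrite (bigD1 a) //= [X in _ + X]big1 ?addr0 => [|b ba].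
  apply: eq_bigr => i _; rewrite row_std_basis !mxE !copy_idx_div !copy_idx_mod /=.
  by rewrite eqxx.
rewrite big1 // => i _; rewrite !mxE !copy_idx_div /=.
by rewrite -val_eqE /= in ba; rewrite (negPf ba) scale0r.
Qed.

Lemma act_triv_basis X : \tr X = 0 -> triv_basis *m (rho X)^T = 0.
Proof.
move=> X0; apply/row_matrixP => i; rewrite row_mul row0.
have w0 : wt (fun=> 0) (row i triv_basis) by apply/sub_ZBP; exact: row_sub.
rewrite (act_wt X0 w0) big1 // => a _; rewrite big1 // => b _.
by case: eqVneq => [_|ab]; rewrite ?scale0r ?(T_wt0_eq0 ab w0) scaler0.
Qed.

Lemma iso_model : iso_rep rho
  (@model_rep R (\rank std_mult) (\rank (kermx (row_mx (Hm 0 1) (Hm 1 2))))).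
Proof.
set m := \rank (kermx _).
have model_basisE X : \tr X = 0 ->
    model_basis *m (rho X)^T = (@model_rep R (\rank std_mult) m X)^T *m model_basis.
  move=> X0; rewrite /model_rep /sum_rep /triv_rep !tr_block_mx !trmx0 /model_basis.
  rewrite (mul_col_mx sym_basis) (mul_col_mx std_basis) (act_sym_basis X0).
  rewrite (act_std_basis X0) (act_triv_basis X0).
  by rewrite !mul_block_col !mul0mx !add0r !addr0.
(* The type of [model_basis] is not square, so its left and right inverses are identified by
   hand. *)
have /row_freeP[P QP] := model_basis_free; have PQ : P *m model_basis = 1%:M.
  have /row_fullP[P' PQ'] := model_basis_full.
  by rewrite -[P in LHS]mul1mx -PQ' -[P' *m model_basis *m P]mulmxA QP mulmx1.
exists P^T; split.
- by apply/row_freeP; exists model_basis^T; rewrite -trmx_mul QP trmx1.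
- by apply/row_fullP; exists model_basis^T; rewrite -trmx_mul PQ trmx1.
- move=> X X0; apply: trmx_inj; rewrite !trmx_mul !trmxK.
  rewrite -[LHS]mul1mx -PQ -!mulmxA [model_basis *m (_ *m P)]mulmxA (model_basisE X X0).
  by rewrite -!mulmxA QP mulmx1.
Qed.

End SquareWeight.
End Rep.

(** * Duality *)

Section Dual.
Variable R : rcfType.

(** Twist by the outer automorphism of sl_3. It negates weights as duality does, but keeps the space
    W and leaves the same [wedge] equivariant. *)
Definition contragredient n (rho : 'M[R]_3 -> 'M[R]_n) (X : 'M[R]_3) := rho (- X^T).

Lemma tr_contragredient (X : 'M[R]_3) : \tr X = 0 -> \tr (- X^T) = 0.
Proof. by rewrite raddfN /= mxtrace_tr => ->; rewrite oppr0. Qed.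

Section Rho.
Variables (n : nat) (rho : 'M[R]_3 -> 'M[R]_n).

Lemma contragredient_lie : lie_rep rho -> lie_rep (contragredient rho).
Proof.
case=> L B; split=> [a X Y X0 Y0|X Y X0 Y0]; rewrite /contragredient.
  rewrite -L ?tr_contragredient //; congr rho.
  by rewrite linearP /= opprD scalerN.
rewrite -B ?tr_contragredient //; congr rho.
by rewrite linearB /= !trmx_mul !mulNmx !mulmxN !opprK opprB.
Qed.

Lemma contragredient_equivariant wedge :
  equivariant rho wedge -> equivariant (contragredient rho) wedge.
Proof. by move=> E X /tr_contragredient X0 a b; exact: (E _ X0). Qed.
End Rho.

Lemma sym_idxE : [/\ [/\ sym_idx 0 0 = 0, sym_idx 1 1 = 1 & sym_idx 2 2 = 2],
   [/\ sym_idx 0 1 = 3, sym_idx 0 2 = 4 & sym_idx 1 2 = 5] &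
   [/\ sym_idx 1 0 = 3, sym_idx 2 0 = 4 & sym_idx 2 1 = 5]].
Proof. by split; split; apply: val_inj; rewrite /= inordK. Qed.

Lemma sym2dualE (X : 'M[R]_3) k l : sym2dual_rep X k l =
  - (\sum_b (sym_idx (p1 k) b == l)%:R * X b (p2 k) +
     \sum_b X b (p1 k) * (sym_idx b (p2 k) == l)%:R).
Proof.
rewrite !mxE; congr (- (_ + _)); apply: eq_bigr => b _; rewrite !mxE;
  by rewrite ?andbT.
Qed.

(* The Gram matrix of the trace form tr (S S') in the coordinates of Sym_2: the
   adjoint of the action of X is the action of its transpose. *)
Definition gram6 : 'rV[R]_6 := \row_k (if p1 k == p2 k then 1 else 2%:R).

Lemma gram6_sym2dual Y :
  diag_mx gram6 *m sym2dual_rep (- Y^T) = - (sym2dual_rep Y)^T *m diag_mx gram6.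
Proof.
have key k l : (if p1 k == p2 k then 1 else 2%:R) * sym2dual_rep (- Y^T) k l =
    - sym2dual_rep Y l k * (if p1 l == p2 l then 1 else 2%:R).
  rewrite !sym2dualE !big_ord3 !mxE.
  have [[a0 a1 a2] [a3 a4 a5] [b0 b1 b2] [b3 b4 b5]] := p12E.
  have [[c0 c1 c2] [c3 c4 c5] [d3 d4 d5]] := sym_idxE.
  pose pE := (a0, a1, a2, a3, a4, a5, b0, b1, b2, b3, b4, b5).
  pose sE := (c0, c1, c2, c3, c4, c5, d3, d4, d5).
  by case: (ord6P k) => [[]||[]] ->; case: (ord6P l) => [[]||[]] ->;
    rewrite !pE !sE /=; ring.
apply/matrixP => k l; rewrite mul_diag_mx mul_mx_diag mxE [RHS]mxE.
by rewrite [gram6 _ _]mxE [gram6 _ l]mxE key; congr (_ * _); rewrite !mxE.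
Qed.

Lemma gram6_unit : diag_mx gram6 \in unitmx.
Proof.
rewrite unitmxE det_diag unitfE; apply/prodf_neq0 => k _; rewrite mxE.
by case: ifP => _; rewrite ?oner_neq0 // pnatr_eq0.
Qed.

Lemma stdk_dual k (Y : 'M[R]_3) : stdk_rep k (- Y^T) = - (stdk_rep k Y)^T.
Proof.
apply/matrixP => i j; rewrite !mxE eq_sym.
by case: ifP => _; rewrite ?oppr0.
Qed.

(** The twisted model is its dual: literally on E^k and T^m, and after a change of basis by the Gram
    matrix on Sym_2. *)
Lemma model_dual k m : exists2 C, C \in unitmx &
  forall Y, C *m @model_rep R k m (- Y^T) = dual_rep (@model_rep R k m) Y *m C.
Proof.
exists (block_mx (diag_mx gram6) 0 0 1%:M).
  by rewrite unitmxE det_ublock det1 mulr1 -unitmxE gram6_unit.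
move=> Y; rewrite /dual_rep /model_rep /sum_rep /triv_rep !tr_block_mx !trmx0.
rewrite !opp_block_mx !oppr0 !mulmx_block !mulmx0 !mul0mx !addr0 !add0r.
by rewrite gram6_sym2dual stdk_dual mul1mx mulmx1.
Qed.

Lemma iso_rep_contragredient n (rho : 'M[R]_3 -> 'M[R]_n) k m :
  iso_rep (contragredient rho) (@model_rep R k m) ->
  iso_rep rho (dual_rep (@model_rep R k m)).
Proof.
case=> P [/row_freeP[A PA] /row_fullP[B BP] E]; have [C Cu CE] := model_dual k m.
exists (C *m P); split.
- apply/row_freeP; exists (A *m invmx C).
  by rewrite mulmxA -(mulmxA C) PA mulmx1 mulmxV.
- apply/row_fullP; exists (B *m invmx C).
  by rewrite mulmxA -(mulmxA B) mulVmx // mulmx1.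
- move=> Y Y0; have := E _ (tr_contragredient Y0).
  rewrite /contragredient linearN /= trmxK opprK => EY.
  by rewrite -mulmxA EY mulmxA CE mulmxA.
Qed.

Lemma tr0_contragredient (X : 'M[R]_3) : - (tr0 X)^T = tr0 (- X^T).
Proof.
have tE : \tr (- X^T) = - \tr X by rewrite raddfN /= mxtrace_tr.
rewrite /tr0 tE; move: (\tr X) => t; apply/matrixP => a b; rewrite !mxE eq_sym.
by case: (a == b); rewrite ?mulr1n ?mulr0n; ring.
Qed.

Lemma T_contragredient n' (rho : 'M[R]_3 -> 'M[R]_n'.+1) i j w : lie_rep rho ->
  T (contragredient rho) i j w = - T rho j i w.
Proof.
move=> rhoL; rewrite !TE /M -mulmxN -linearN /=; congr (_ *m _^T).
have gN X : - gl rho X = gl rho (- X).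
  have := gl_is_linear rhoL (-1) X 0; have := gl_is_linear rhoL 1 0 0.
  rewrite !scaleN1r !scale1r !addr0 => g0.
  have -> : gl rho 0 = 0 by apply: (addrI (gl rho 0)); rewrite addr0 -g0.
  by rewrite addr0 => ->.
rewrite gN /gl /contragredient tr0_contragredient trmx_delta.
by [].
Qed.

Lemma H_contragredient n' (rho : 'M[R]_3 -> 'M[R]_n'.+1) i j w : lie_rep rho ->
  H (contragredient rho) i j w = - H rho i j w.
Proof. by move=> rhoL; rewrite !HE !T_contragredient // opprB opprK addrC. Qed.

End Dual.

Theorem mainTheorem15 (R : rcfType) (n : nat) (rho : 'M[R]_3 -> 'M[R]_n)
    (wedge : 'rV[R]_n -> 'rV[R]_n -> 'rV[R]_n) :
  lie_rep rho -> faithful_rep rho ->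
  symmetric_bilinear wedge -> equivariant rho wedge ->
  nonvanishing_on_planes wedge ->
  exists k m : nat,
    iso_rep rho (@model_rep R k m) \/ iso_rep rho (dual_rep (@model_rep R k m)).
Proof.
case: n rho wedge => [|n'] rho wedge rhoL rhoF wS wE wP.
  (* In dimension 0 the representation kills E_01, against faithfulness. *)
  have X0 : \tr (delta_mx 0 1 : 'M[R]_3) = 0 by rewrite /mxtrace big_ord3 !mxE /= !addr0.
  have /matrixP/(_ 0 1) := rhoF _ X0 (thinmx0 _).
  by rewrite !mxE => /eqP; rewrite oner_eq0.
have [v v0 [v_sq|v_sq]] := exists_square_weight rhoL wS wE wP rhoF; last first.
  have I := iso_model rhoL wS wE wP v0 v_sq.
  by do 2!eexists; left; exact: I.
pose rho' := contragredient rho.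
have rhoL' : lie_rep rho' by exact: contragredient_lie.
have wE' : equivariant rho' wedge by exact: contragredient_equivariant.
have v_sq' : wt rho' (sq 0) v.
  move=> i j; rewrite H_contragredient // v_sq -scaleNr -rmorphN /sq.
  by congr (_%:~R *: _); ring.
(* The decomposition starts from the weight -2 eps_2, and E_02 applied twice moves -2 eps_0
   there. *)
pose u := T rho' 0 2 (T rho' 0 2 v).
have u0 : u != 0.
  apply: contraNneq v0 => u0; apply/eqP.
  have Hv : H rho' 0 2 v = - 2 *: v by rewrite v_sq'.
  exact: (ee_inj rhoL' wS wE' wP _ Hv u0).
have u_sq : wt rho' (sq 2) u.
  apply: (wt_ext _ (wtT rhoL' 0 2 (wtT rhoL' 0 2 v_sq'))) => i j.
  by rewrite /sq; ring.
have I := iso_rep_contragredient (iso_model rhoL' wS wE' wP u0 u_sq).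
by do 2!eexists; right; exact: I.
Qed.
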